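(* Let $d\ge 2$ be an integer, $\lambda>0$, $\alpha>0$, and let $X_1,X_2,\ldots$ be i.i.d. random vectors in $\mathbb{R}^d$ with density $f(x)=A_d e^{-\lambda\|x\|^\alpha}$. Let $d_n$ be the largest nearest neighbor distance of $\mathcal{X}_n=\{X_1,\ldots,X_n\}$. Then, almost surely, $$\liminf_{n\to\infty}\frac{(\lambda^{-1}\log n)^{1-1/\alpha}\,d_n}{\log_2 n}\ge\frac{d-1}{\alpha\lambda} \qquad\text{and}\qquad \limsup_{n\to\infty}\frac{(\lambda^{-1}\log n)^{1-1/\alpha}\,d_n}{\log_2 n}\le\frac{d}{\alpha\lambda}.$$
   Context: $\|\cdot\|$ is the Euclidean norm on $\mathbb{R}^d$, and $A_d=\frac{\alpha\lambda^{d/\alpha}\Gamma(d/2+1)}{d\pi^{d/2}\Gamma(d/\alpha)}$ is the normalizing constant making $f$ a probability density. The nearest neighbor graph $G_n$ on $\mathcal{X}_n$ is obtained by joining each point of $\mathcal{X}_n$ to its nearest neighbor in $\mathcal{X}_n$; the largest nearest neighbor distance is the longest edge length of $G_n$, i.e. $d_n=\max_{1\le i\le n}\min_{j\ne i,\,1\le j\le n}\|X_i-X_j\|$. $\log_2 n=\log\log n$ (natural logarithms). *)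

(* Defs.v *)
From HB Require Import structures.
From mathcomp Require Import all_boot all_order all_algebra finmap.
From mathcomp Require Import all_classical all_reals all_analysis.

Set Implicit Arguments.
Unset Strict Implicit.
Unset Printing Implicit Defensive.

Import Order.TTheory GRing.Theory Num.Theory.
Import numFieldNormedType.Exports.

Local Open Scope classical_set_scope.
Local Open Scope ring_scope.

(* R^d, with the product (hence Borel) sigma-algebra that the library puts on
   tuples. measurableTypeR R is R with its Borel sets, on which
   lebesgue_measure is declared; its carrier is convertible to R. *)
Notation Rtuple R d := (d.-tuple (measurableTypeR R)).

Section lebesgue_tuple.
Context (R : realType).

Definition tuple_cons (n : nat) (vx : Rtuple R n * measurableTypeR R) :
  Rtuple R n.+1 := [tuple of vx.2 :: vx.1].

Lemma measurable_tuple_cons (n : nat) : measurable_fun setT (@tuple_cons n).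
Proof. by apply: measurable_cons. Qed.

Section step.
Context (n : nat) (m : {measure set (Rtuple R n) -> \bar R}).

Definition lebesgue_tupleS : set (Rtuple R n.+1) -> \bar R :=
  pushforward (m \x @lebesgue_measure R)%E (@tuple_cons n).

Let lebesgue_tupleS_measure : {measure set (Rtuple R n.+1) -> \bar R} :=
  measure_function_pushforward__canonical__measure_function_Measure
    (m \x @lebesgue_measure R)%E (@measurable_tuple_cons n).

HB.instance Definition _ := Measure.copy lebesgue_tupleS
  lebesgue_tupleS_measure.

End step.

(* d-dimensional Lebesgue measure, by iterated products transported along
   (v, x) |-> x :: v; lebesgue_tuple_box gives its value on boxes. *)
Fixpoint lebesgue_tuple (n : nat) : {measure set (Rtuple R n) -> \bar R} :=
  match n with
  | 0 => \d_([tuple] : Rtuple R 0)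
  | n'.+1 => lebesgue_tupleS (lebesgue_tuple n')
  end.

Lemma lebesgue_tuple_box (n : nat) (A : 'I_n -> set (measurableTypeR R)) :
  (forall i, measurable (A i)) ->
  lebesgue_tuple n [set v | forall i, A i (tnth v i)] =
  (\prod_(i < n) lebesgue_measure (A i))%E.
Proof.
elim: n A => [|n IHn] A mA.
  rewrite big_ord0 /= diracE mem_set//.
  by case.
rewrite big_ord_recl /= /lebesgue_tupleS /pushforward.
have -> : @tuple_cons n @^-1` [set v | forall i, A i (tnth v i)] =
  [set v : Rtuple R n | forall i, A (lift ord0 i) (tnth v i)] `*` A ord0.
  apply/seteqP; split => -[v x] /=.
    move=> h; split=> [i|]; last exact: (h ord0).
    by have := h (lift ord0 i); rewrite /tuple_cons tnthS.
  move=> [h1 h2] i; case: (unliftP ord0 i) => [j|] ->.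
    by rewrite /tuple_cons tnthS.
  exact: h2.
rewrite product_measure1E//; last first.
  rewrite (_ : [set _ | _] =
    \bigcap_(i in [set: 'I_n]) ((@tnth n (measurableTypeR R))^~ i @^-1`
      A (lift ord0 i))).
    apply: fin_bigcap_measurable => // i _.
    by rewrite -[X in measurable X]setTI; apply: measurable_tnth.
  by apply/seteqP; split => v /= h i => [_|]; exact: h.
by rewrite (IHn (fun i => A (lift ord0 i)))// muleC.
Qed.

End lebesgue_tuple.

Section euclidean.
Context (R : realType) (d : nat).

Definition enorm (x : d.-tuple R) : R :=
  Num.sqrt (\sum_(i < d) tnth x i ^+ 2).

Definition edist (x y : d.-tuple R) : R :=
  enorm [tuple tnth x i - tnth y i | i < d].

End euclidean.

Definition Gamma (R : realType) (a : R) : R :=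
  \int[@lebesgue_measure R]_(t in `]0, +oo[) (t `^ (a - 1) * expR (- t)).

Definition norm_const (R : realType) (d : nat) (lambda alpha : R) : R :=
  alpha * lambda `^ (d%:R / alpha) * Gamma (d%:R / 2 + 1) /
  (d%:R * pi `^ (d%:R / 2) * Gamma (d%:R / alpha)).

Definition exp_power_pdf (R : realType) (d : nat) (lambda alpha : R)
    (x : d.-tuple R) : R :=
  norm_const d lambda alpha * expR (- (lambda * enorm x `^ alpha)).

Section random_vectors.
Context (dT : measure_display) (T : measurableType dT) (R : realType)
  (P : probability T R).

Definition mutually_independent (d' : measure_display)
    (T' : measurableType d') (X : nat -> {RV P >-> T'}) : Prop :=
  forall (J : {fset nat}) (B : nat -> set T'),
    (forall j, j \in J -> measurable (B j)) ->
    (P (\bigcap_(j in [set` J]) (X j @^-1` B j)) =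
     \prod_(j <- J) P (X j @^-1` B j))%E.

Definition has_density (d : nat) (X : {RV P >-> Rtuple R d})
    (f : d.-tuple R -> R) : Prop :=
  forall B : set (Rtuple R d), measurable B ->
    distribution P X B = (\int[lebesgue_tuple R d]_(x in B) (f x)%:E)%E.

End random_vectors.

(* The points X_1, ..., X_n are indexed as x 0, ..., x n.-1. The value is
   extended-real: for n = 1 the empty minimum makes it +oo and for n = 0 the
   empty maximum makes it -oo; it is finite for n >= 2. *)
Definition largest_nn_dist (R : realType) (d : nat) (x : nat -> d.-tuple R)
    (n : nat) : \bar R :=
  (\big[maxe/-oo]_(i < n) \big[mine/+oo]_(j < n | j != i)
     (edist (x i) (x j))%:E)%E.

(* Main.v *)
(* Put L = log n and R = (L / lambda)^(1/alpha), and consider a point x with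
   lambda |x|^alpha = L + s log L.  The ball of radius r = q R log L / L around
   x is expected to contain L^(d/alpha - d + alpha q - s) sample points up to
   powers of log L, because the density increases by the factor L^(alpha q)
   from x to the point of the ball nearest to the origin.  About
   L^(d/alpha - 1 - s) sample points lie at level s, so the expected number of
   isolated points is L^(d - 1 - alpha q).  Along n = 2^k, where L is of order
   k, this is summable if alpha q > d, whence the upper bound; isolation is
   tested against the first 2^k points for all points with index below
   2^(k+1), which covers a whole dyadic block.  If alpha q < d - 1, consider m
   separated cones cut at a level where each contains a sample point, up to a
   stretched exponentially small probability, and where most sample points are
   isolated.  If none of them is isolated, there are m close pairs with
   disjoint indices, an event of probability L^(- m t) for some t > 0, which is
   summable for m large.
   Partitioning space into small cells reduces the events to rectangles, so
   that mutual independence is used as it stands, without Fubini. *)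

(* Let a point have density value [M], let [m] other points be present, and let a test set of volume
   [v] inside its ball have density at least [e^G M]. It is isolated with probability at most
   [exp(- m e^G M v)]. Weighting by [M] and using [exp(- y) <= 1 / y] cancels [M], so the level
   drops out and one estimate serves the whole intermediate annulus. Its edges are chosen so that
   below it isolation is negligible even after a union over all indices, and above it a sample point
   is itself improbable. For the lower bound, the expected number of close pairs decays only like a
   small power of [L], which need not be summable over the blocks. Counts in different regions of a
   sample of fixed size are dependent, so this bound cannot simply be raised to a power; but pairs
   in disjoint neighborhoods of cones use distinct indices, and for distinct indices joint
   probabilities are products. Two coordinates already provide any number of cones. The upper bound
   is a union bound whose summation over blocks costs a full factor [L]: hence [d] against [d - 1].
   Exceptional events are only covered by measurable sets of small probability. *)
Require Import Defs.
From mathcomp Require Import all_boot all_order all_algebra finmap.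
From mathcomp Require Import all_classical all_reals all_analysis.
From mathcomp Require Import measurable_realfun.
From mathcomp Require Import ring lra zify.

Import Order.TTheory GRing.Theory Num.Theory.
Import numFieldNormedType.Exports.

Local Open Scope classical_set_scope.
Local Open Scope ring_scope.

Set Implicit Arguments.
Unset Strict Implicit.
Unset Printing Implicit Defensive.

(* [edist] on its own is the extended distance of MathComp-Analysis. *)
Local Notation edist := Defs.edist.

(** * Euclidean norm *)

Section euclidean_norm.
Context (R : realType) (d : nat).
Implicit Types (x y z : Rtuple R d) (u v : 'I_d -> R) (t : R).

Let norm2 u : R := Num.sqrt (\sum_(i < d) u i ^+ 2).

Let sumsq_ge0 u : 0 <= \sum_(i < d) u i ^+ 2.
Proof. by apply: sumr_ge0 => i _; exact: sqr_ge0. Qed.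

Let norm2_sqr u : norm2 u ^+ 2 = \sum_(i < d) u i ^+ 2.
Proof. by rewrite sqr_sqrtr. Qed.

Let norm2_eq0 u : norm2 u = 0 -> forall i, u i = 0.
Proof.
move=> /eqP; rewrite sqrtr_eq0 => h i.
have : \sum_(i < d) u i ^+ 2 == 0 by rewrite eq_le h sumsq_ge0.
rewrite psumr_eq0; last by move=> *; exact: sqr_ge0.
by move=> /allP/(_ i (mem_index_enum i)); rewrite sqrf_eq0 => /eqP.
Qed.

(* Cauchy-Schwarz: sum [2 a b u_i v_i <= b^2 u_i^2 + a^2 v_i^2] with
   [a = |u|] and [b = |v|]. *)
Let cauchy_schwarz u v : \sum_(i < d) u i * v i <= norm2 u * norm2 v.
Proof.
have [u0|u0] := eqVneq (norm2 u) 0.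
  rewrite u0 mul0r big1// => i _; by rewrite norm2_eq0// mul0r.
have [v0|v0] := eqVneq (norm2 v) 0.
  rewrite v0 mulr0 big1// => i _; by rewrite (norm2_eq0 v0)// mulr0.
have a0 : 0 < norm2 u by rewrite lt_neqAle eq_sym u0 sqrtr_ge0.
have b0 : 0 < norm2 v by rewrite lt_neqAle eq_sym v0 sqrtr_ge0.
set a := norm2 u in a0 *; set b := norm2 v in b0 *.
rewrite -(ler_pM2l (_ : 0 < 2 * a * b)); last by rewrite !mulr_gt0.
rewrite [leRHS](_ : _ = b ^+ 2 * (\sum_(i < d) u i ^+ 2) +
    a ^+ 2 * (\sum_(i < d) v i ^+ 2)); last by rewrite -!norm2_sqr -/a -/b;
      ring.
rewrite !mulr_sumr -big_split/=.
apply: ler_sum => i _.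
have := sqr_ge0 (b * u i - a * v i). lra.
Qed.

Let minkowski u v : norm2 (fun i => u i + v i) <= norm2 u + norm2 v.
Proof.
have [a0 b0] : 0 <= norm2 u /\ 0 <= norm2 v by rewrite !sqrtr_ge0.
rewrite -(@ler_pXn2r _ 2) ?nnegrE ?addr_ge0 ?sqrtr_ge0//.
rewrite sqrrD !norm2_sqr.
under eq_bigr do rewrite sqrrD.
rewrite !big_split/= lerD2r lerD2l. rewrite -mulr2n lerMn2r/=.
exact: cauchy_schwarz.
Qed.

Lemma enorm_ge0 x : 0 <= enorm x. Proof. exact: sqrtr_ge0. Qed.

Lemma edistE x y : edist x y = Num.sqrt (\sum_(i < d) (tnth x i - tnth y i) ^+
  2).
Proof. by congr Num.sqrt; apply: eq_bigr => i _; rewrite tnth_mktuple. Qed.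

Lemma edistC x y : edist x y = edist y x.
Proof. by rewrite !edistE; congr Num.sqrt; apply: eq_bigr => i _;
  rewrite -sqrrN opprB. Qed.

Lemma edist_triangle y x z : edist x z <= edist x y + edist y z.
Proof.
rewrite !edistE; apply: le_trans (minkowski _ _) => //=.
by rewrite le_eqVlt; apply/orP/or_introl/eqP; congr Num.sqrt;
  apply: eq_bigr => i _; congr (_ ^+ 2); ring.
Qed.

Lemma enorm_le_edist x y : enorm x <= enorm y + edist x y.
Proof.
rewrite edistE; apply: le_trans (minkowski _ _).
by rewrite le_eqVlt; apply/orP/or_introl/eqP; congr Num.sqrt;
  apply: eq_bigr => i _; congr (_ ^+ 2); ring.
Qed.

Let coord_le_norm2 u i : `|u i| <= norm2 u.
Proof.
rewrite -sqrtr_sqr ler_wsqrtr// (bigD1 i)//= lerDl.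
by apply: sumr_ge0 => j _; exact: sqr_ge0.
Qed.

Lemma tnth_le_enorm x i : `|tnth x i| <= enorm x.
Proof. exact: coord_le_norm2. Qed.

Lemma tnth_le_edist x y i : `|tnth x i - tnth y i| <= edist x y.
Proof. by rewrite edistE; exact: (coord_le_norm2 (fun i => tnth x i - tnth y
  i)). Qed.

(** Crude, as the sharp factor is the square root of [d]. It serves to pass between cubes, whose
    volumes are explicit, and Euclidean distances. *)
Let norm2_le u t : 0 <= t -> (forall i, `|u i| <= t) -> norm2 u <= d%:R * t.
Proof.
move=> t0 ut; rewrite -(@ler_pXn2r _ 2) ?nnegrE ?mulr_ge0 ?sqrtr_ge0//.
rewrite norm2_sqr exprMn; apply: (@le_trans _ _ (\sum_(i < d) t ^+ 2)).
  apply: ler_sum => i _; rewrite -real_normK ?num_real//.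
  by rewrite ler_pXn2r ?nnegrE.
rewrite sumr_const card_ord -[leLHS]mulr_natl ler_wpM2r ?sqr_ge0//.
by rewrite -natrX ler_nat -mulnn; case: (d) => // n; rewrite leq_pmulr.
Qed.

Lemma enorm_le x t : 0 <= t -> (forall i, `|tnth x i| <= t) ->
  enorm x <= d%:R * t.
Proof. exact: norm2_le. Qed.

Lemma edist_le x y t : 0 <= t -> (forall i, `|tnth x i - tnth y i| <= t) ->
  edist x y <= d%:R * t.
Proof. by move=> t0 h; rewrite edistE; exact: (norm2_le (u := fun i => tnth x i
  - tnth y i)). Qed.

Definition tscale t (x : Rtuple R d) : Rtuple R d := [tuple t * tnth x i | i <
  d].

Lemma tnth_tscale t x i : tnth (tscale t x) i = t * tnth x i.
Proof. by rewrite tnth_mktuple. Qed.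

Let norm2Z t u : norm2 (fun i => t * u i) = `|t| * norm2 u.
Proof.
rewrite -sqrtr_sqr -sqrtrM ?sqr_ge0// mulr_sumr; congr Num.sqrt.
by apply: eq_bigr => i _; rewrite exprMn.
Qed.

Lemma enormZ t x : enorm (tscale t x) = `|t| * enorm x.
Proof.
rewrite -norm2Z; congr Num.sqrt; apply: eq_bigr => i _.
by rewrite tnth_tscale.
Qed.

Lemma edist_tscaler t x : edist x (tscale t x) = `|1 - t| * enorm x.
Proof.
rewrite -norm2Z edistE; congr Num.sqrt; apply: eq_bigr => i _.
by rewrite tnth_tscale mulrBl mul1r.
Qed.

(** The density increases toward the origin, so this [y] is the best point of the ball around [x].
    The maximum with 0 covers the balls that contain the origin. *)
Lemma shrink_toward_origin x t : 0 <= t ->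
  exists y, edist x y <= t /\ enorm y <= Num.max 0 (enorm x - t).
Proof.
move=> t0; have [xt|xt] := leP (enorm x) t.
  exists (tscale 0 x); rewrite edist_tscaler enormZ subr0 normr1 mul1r.
  by rewrite normr0 mul0r le_max lexx.
have x0 : 0 < enorm x by exact: le_lt_trans xt.
exists (tscale (1 - t / enorm x) x); rewrite edist_tscaler enormZ.
have h : 0 <= t / enorm x <= 1.
  by rewrite divr_ge0 ?ler_pdivrMr ?mul1r ?(ltW xt) ?(ltW x0).
rewrite subKr !ger0_norm ?subr_ge0; try by case/andP: h.
rewrite divfK ?gt_eqF// lexx; split => //.
by rewrite le_max mulrBl mul1r divfK ?gt_eqF// lexx orbT.
Qed.

End euclidean_norm.

(** * Scaling of Lebesgue measure *)

Section lebesgue_scaling.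
Context (R : realType).
Local Open Scope ereal_scope.

Let mul_measurable (t : R) :
  measurable_fun setT (fun x : measurableTypeR R => t * x : measurableTypeR
    R)%R.
Proof. exact: measurable_funM. Qed.

(** The pushforward under scaling, multiplied by [t], has the Lebesgue value on half-open intervals,
    so uniqueness identifies it with Lebesgue measure. *)
Lemma lebesgue_measureZ (t : R) (A : set (measurableTypeR R)) : (0 < t)%R ->
  measurable A ->
  lebesgue_measure ((fun x : measurableTypeR R => t * x : measurableTypeR R)%R
    @^-1` A) =
  t^-1%:E * lebesgue_measure A.
Proof.
move=> t0 mA.
have tn : (0 <= t)%R by exact: ltW.
pose nu : {measure set (measurableTypeR R) -> \bar R} :=
  mscale (NngNum tn)
    (measure_function_pushforward__canonical__measure_function_Measure
    (@lebesgue_measure R) (mul_measurable t)).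
have -> : lebesgue_measure A = nu A.
  apply: lebesgue_measure_unique => //= _ [[a b]] _ <-.
  rewrite /nu /mscale/= /pushforward/=.
  have -> : (fun x : R => t * x)%R @^-1` `]a, b] = `](t^-1 * a)%R,
    (t^-1 * b)%R]%classic.
    by apply/seteqP; split => x /=; rewrite !in_itv/= ltr_pdivrMl// ler_pdivlMl.
  rewrite !lebesgue_measure_itv/= !lte_fin ltr_pM2l ?invr_gt0//.
  case: ifPn => _; last by rewrite mule0.
  by rewrite -!EFinB -EFinM -mulrBr mulrA divff ?gt_eqF// mul1r.
by rewrite /nu /mscale/= muleA -EFinM mulVf ?gt_eqF// mul1e.
Qed.

Lemma measurable_tscale (n : nat) (t : R) :
  measurable_fun setT (tscale t : Rtuple R n -> Rtuple R n).
Proof.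
apply/measurable_fun_tnthP => i.
rewrite (_ : _ \o _ = fun x : Rtuple R n => (t * tnth x i)%R); last first.
  by apply/funext => x /=; rewrite tnth_tscale.
apply: measurable_funM => //; exact: measurable_tnth.
Qed.

Lemma tscale_cons (n : nat) (t : R) (v : Rtuple R n) (x : measurableTypeR R) :
  tscale t (tuple_cons (v, x)) = tuple_cons (tscale t v,
    t * x : measurableTypeR R)%R.
Proof.
apply: eq_from_tnth => i; rewrite tnth_tscale /tuple_cons.
by case: (unliftP ord0 i) => [j|] ->; rewrite ?tnthS ?tnth0//= tnth_tscale.
Qed.

(** Induction on the dimension. The section of the scaled set at [v] is the scaled section at
    [tscale t v], which gives one factor [t^-1]; the induction hypothesis, read as an equality of
    the pushforward with a multiple of the measure, gives the other [n]. *)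
Lemma lebesgue_tupleZ (n : nat) (t : R) (A : set (Rtuple R n)) : (0 < t)%R ->
  measurable A ->
  lebesgue_tuple R n (tscale t @^-1` A) = (t^-1 ^+ n)%:E * lebesgue_tuple R n A.
Proof.
move=> t0; elim: n A => [|n IHn] A mA.
  rewrite expr0 mul1e; congr (lebesgue_tuple R 0 _).
  by apply/seteqP; split => x /=; rewrite (tuple0 (tscale t x)) (tuple0 x).
have cn : (0 <= t^-1 ^+ n)%R by rewrite exprn_ge0// invr_ge0 ltW.
have mcA : measurable (@tuple_cons R n @^-1` A).
  by rewrite -[X in measurable X]setTI; apply: measurable_tuple_cons.
pose g (v : Rtuple R n) := lebesgue_measure (xsection (@tuple_cons R n @^-1` A)
  v).
have mg : measurable_fun setT g by exact: measurable_fun_xsection.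
have E B : lebesgue_tuple R n.+1 B = lebesgue_tupleS (lebesgue_tuple R n) B by
  [].
rewrite !{}E /lebesgue_tupleS /pushforward /product_measure1.
move: (lebesgue_tuple R n) IHn => mu IHn.
transitivity (\int[mu]_v (t^-1%:E * g (tscale t v))).
  apply: eq_integral => v _ /=; rewrite /g -lebesgue_measureZ//;
    last exact: measurable_xsection.
  congr lebesgue_measure; apply/seteqP; split => x; rewrite /xsection/= !inE/=.
    by rewrite -tscale_cons.
  by rewrite -tscale_cons.
have mtg : measurable_fun setT (g \o tscale t).
  by apply: measurableT_comp => //; exact: measurable_tscale.
rewrite ge0_integralZl//; last by rewrite lee_fin invr_ge0 ltW.
have -> : \int[mu]_v g (tscale t v) = \int[pushforward mu (tscale t)]_v g v.
  by rewrite [RHS]ge0_integral_pushforward ?preimage_setT//;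
    exact: measurable_tscale.
have -> : \int[pushforward mu (tscale t)]_v g v =
    \int[mscale (NngNum cn) mu]_v g v.
  apply: (@eq_measure_integral _ _ _ _ _
    (measure_function_pushforward__canonical__measure_function_Measure
       mu (@measurable_tscale n t))) => B mB _.
  by rewrite /= /pushforward/= IHn.
by rewrite ge0_integral_mscale//= exprS EFinM -muleA.
Qed.

End lebesgue_scaling.

Lemma measure_setD_fin (dd : measure_display) (S : measurableType dd)
  (R : realType) (mu : {measure set S -> \bar R}) (A B : set S) (a b : R) :
  measurable A -> measurable B -> B `<=` A -> mu A = a%:E -> mu B = b%:E ->
  mu (A `\` B) = (a - b)%:E.
Proof.
move=> mA mB BA muA muB.
have moo : (mu A < +oo)%E by rewrite muA ltry.
have -> : mu (A `\` B) = (mu A - mu (A `&` B))%E by exact: measureD.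
by rewrite (setIidr BA) muA muB.
Qed.

Section balls_and_cubes.
Context (R : realType) (n : nat).
Implicit Types (x : Rtuple R n) (t a b : R).

(* [R] and [measurableTypeR R] carry the same measurable sets under different
   displays. *)
Lemma measurable_tnthR i :
  measurable_fun setT ((fun x => tnth x i) : Rtuple R n -> R).
Proof. by move=> _ Y mY; exact: (@measurable_tnth _ (measurableTypeR R) n i).
  Qed.

Lemma measurable_enorm : measurable_fun setT (@enorm R n : Rtuple R n -> R).
Proof.
apply: (measurableT_comp (continuous_measurable_fun (@sqrt_continuous R))).
apply: measurable_sum => i; apply: measurable_funX; exact: measurable_tnthR.
Qed.

Definition annulus a b : set (Rtuple R n) := [set x | a < enorm x <= b].

Definition cube x t : set (Rtuple R n) :=
  [set v | forall i, `|tnth v i - tnth x i| <= t].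

Definition eball t : set (Rtuple R n) := [set x | enorm x <= t].

Lemma measurable_eball t : measurable (eball t).
Proof.
rewrite (_ : eball t = @enorm R n @^-1` `]-oo, t]).
  by rewrite -[X in measurable X]setTI; apply: measurable_enorm.
by apply/seteqP; split => x /=; rewrite /eball/= in_itv.
Qed.

Lemma annulusE a b : annulus a b = eball b `\` eball a.
Proof.
by apply/seteqP; split => x; rewrite /annulus /eball/=;
  [move=> /andP[ax ->]|move=> [->] /negP; rewrite -ltNge => ->]; split => //;
  apply/negP; rewrite -ltNge.
Qed.

Lemma measurable_annulus a b : measurable (annulus a b).
Proof. by rewrite annulusE; apply: measurableD; exact: measurable_eball. Qed.

Lemma cubeE x t : cube x t =
  [set v | forall i, (`[tnth x i - t, tnth x i +
    t]%classic : set (measurableTypeR R)) (tnth v i)].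
Proof.
apply/seteqP; split => v /= h i; have := h i; rewrite /cube/= in_itv/=.
  by rewrite ler_distl.
by rewrite ler_distl.
Qed.

Lemma measurable_box (A : 'I_n -> set (measurableTypeR R)) :
  (forall i, measurable (A i)) ->
  measurable [set v : Rtuple R n | forall i, A i (tnth v i)].
Proof.
move=> mA; rewrite (_ : [set _ | _] = \bigcap_(i in [set: 'I_n])
  ((@tnth n (measurableTypeR R))^~ i @^-1` A i)).
  apply: fin_bigcap_measurable => // i _.
  by rewrite -[X in measurable X]setTI; apply: measurable_tnth.
by apply/seteqP; split => v /= h i => [_|]; exact: h.
Qed.

Lemma measurable_cube x t : measurable (cube x t).
Proof.
rewrite cubeE.
apply: (measurable_box (A := fun i => `[tnth x i - t,
  tnth x i + t]%classic)) => i.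
exact: measurable_itv.
Qed.

Lemma lebesgue_tuple_cube x t : 0 <= t ->
  lebesgue_tuple R n (cube x t) = ((2 * t) ^+ n)%:E.
Proof.
move=> t0; rewrite cubeE.
rewrite (lebesgue_tuple_box (A := fun i => `[tnth x i - t,
  tnth x i + t]%classic)); last first.
  by move=> i; exact: measurable_itv.
rewrite (eq_bigr (fun=> (2 * t)%:E)).
  by rewrite prodEFin prodr_const card_ord.
move=> i _; rewrite lebesgue_measure_itv/= lte_fin.
case: ltP => [_|]; first by rewrite -EFinB; congr EFin; ring.
rewrite lerD2l => tt; suff -> : t = 0 by rewrite mulr0.
by apply: le_anti; rewrite t0 andbT; lra.
Qed.

Lemma eball_sub_cube t : eball t `<=` cube [tuple 0 | i < n] t.
Proof.
move=> v vt i; rewrite tnth_mktuple subr0; exact: le_trans (tnth_le_enorm _ _)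
  vt.
Qed.

Definition conic (C : set (Rtuple R n)) :=
  forall t x, 0 < t -> C (tscale t x) <-> C x.

(** The part of [C] in the ball of radius [t] is a dilate of its part in the unit ball, so its
    volume is [w * t ^+ n]. The value of [w] stays abstract. *)
Lemma conic_annulus_volume (C : set (Rtuple R n)) : measurable C -> conic C ->
  exists w, [/\ 0 <= w, lebesgue_tuple R n (C `&` eball 1) = w%:E &
    forall a b, 0 < a -> a <= b ->
      lebesgue_tuple R n (C `&` annulus a b) = (w * (b ^+ n - a ^+ n))%:E].
Proof.
move=> mC cC.
have mCB t : measurable (C `&` eball t).
  by apply: measurableI => //; exact: measurable_eball.
have fin t : 0 <= t -> (lebesgue_tuple R n (C `&` eball t) < +oo)%E.
  move=> t0; apply: (@le_lt_trans _ _ (lebesgue_tuple R n (cube [tuple 0 | i <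
    n] t))).
    apply: le_measure; rewrite ?inE//; first exact: measurable_cube.
    by move=> x [_]; exact: eball_sub_cube.
  by rewrite lebesgue_tuple_cube// ltry.
exists (fine (lebesgue_tuple R n (C `&` eball 1))).
have w0 : (0 <= lebesgue_tuple R n (C `&` eball 1))%E by exact: measure_ge0.
have wE : (fine (lebesgue_tuple R n (C `&` eball 1)))%:E =
  lebesgue_tuple R n (C `&` eball 1).
  by rewrite fineK// ge0_fin_numE// fin.
have V t : 0 < t -> lebesgue_tuple R n (C `&` eball t) =
    (fine (lebesgue_tuple R n (C `&` eball 1)) * t ^+ n)%:E.
  move=> t0.
  have -> : C `&` eball t = tscale t^-1 @^-1` (C `&` eball 1).
    apply/seteqP; split => x; rewrite /eball/= enormZ ger0_norm ?invr_ge0 ?(ltW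
      t0)//
       ler_pdivrMl// mulr1 => -[Cx xt]; split => //; apply/(cC t^-1 x) => //;
      by rewrite invr_gt0.
  rewrite lebesgue_tupleZ ?invr_gt0//; first by rewrite invrK EFinM wE muleC.
split; [exact: fine_ge0|by rewrite wE|].
move=> a b a0 ab; have b0 := lt_le_trans a0 ab.
have -> : C `&` annulus a b = (C `&` eball b) `\` (C `&` eball a).
  rewrite annulusE; apply/seteqP; split => x /=.
    by move=> [Cx [xb xa]]; split => // -[].
  by move=> [[Cx xb]] h; split => //; split => // xa; exact: h.
rewrite mulrBr; apply: measure_setD_fin => //; [|exact: V|exact: V].
by move=> x [Cx xa]; split => //; exact: le_trans ab.
Qed.

End balls_and_cubes.

(** * Outer bounds and independence *)

Section outer_bounds.
Context (dT : measure_display) (T : measurableType dT) (R : realType)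
  (P : probability T R).
Implicit Types (A B : set T) (a b : \bar R).
Local Open Scope ereal_scope.

(* Upper bound on the outer probability, so that events need not be shown
   measurable. *)
Definition outer_le A b := exists2 B, measurable B & A `<=` B /\ P B <= b.

Lemma outer_le_measurable A : measurable A -> outer_le A (P A).
Proof. by move=> mA; exists A => //; split. Qed.

Lemma outer_le_sub A B a b : A `<=` B -> a <= b -> outer_le B a -> outer_le A b.
Proof.
move=> AB ab [C mC [BC PC]]; exists C => //; split.
  exact: subset_trans BC.
exact: le_trans ab.
Qed.

Lemma outer_le_set0 b : 0 <= b -> outer_le set0 b.
Proof. by move=> b0; exists set0 => //; split; rewrite ?measure0. Qed.

Lemma outer_leU A B a b : outer_le A a -> outer_le B b ->
  outer_le (A `|` B) (a + b).
Proof.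
move=> [C mC [AC PC]] [D mD [BD PD]]; exists (C `|` D);
  first exact: measurableU.
split; first by move=> w [/AC|/BD] ?; [left|right].
by apply: (@le_trans _ _ (P C + P D)); [exact: measureU2|exact: leeD].
Qed.

Lemma outer_le_bigcup (A : (set T)^nat) (b : nat -> \bar R) :
  (forall k, outer_le (A k) (b k)) ->
  outer_le (\bigcup_k A k) (\sum_(k <oo) b k).
Proof.
move=> h; have /choice[B hB] k : exists C, measurable C /\ A k `<=` C /\ P C <=
  b k.
  by have [C mC [AC PC]] := h k; exists C.
exists (\bigcup_k B k); first by apply: bigcup_measurable => k _; case: (hB k).
split; first by move=> w [k _ Akw]; exists k => //; case: (hB k) => _ [+ _];
  exact.
apply: (@le_trans _ _ (\sum_(k <oo) P (B k))).
  apply: measure_sigma_subadditive => //; first by move=> k; case: (hB k).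
  by apply: bigcup_measurable => k _; case: (hB k).
by apply: lee_nneseries => [k _ _|k _]; [exact: measure_ge0|by case: (hB k) =>
  _ []].
Qed.

Lemma outer_le_bigcup_ord n (A : nat -> set T) b : 0 <= b ->
  (forall i, (i < n)%N -> outer_le (A i) b) ->
  outer_le [set w | exists2 i, (i < n)%N & A i w] (n%:R%:E * b).
Proof.
move=> b0; elim: n => [|n IHn] h.
  by apply: (outer_le_sub (B := set0) (a := 0));
    [move=> w []|rewrite mul0e|exact: outer_le_set0].
apply: (@outer_le_sub _ ([set w | exists2 i, (i < n)%N & A i w] `|` A n)
   (n%:R%:E * b + b)).
- move=> w [i]; rewrite ltnS leq_eqVlt => /orP[/eqP ->|ni] Aiw;
  [by right|by left; exists i].
- by rewrite -[in n.+1%:R]addn1 natrD EFinD ge0_muleDl ?lee_fin// mul1e.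
- by apply: outer_leU; [apply: IHn => i ni; apply: h; exact: ltnW|exact: h].
Qed.

(** The usual lemma applied to measurable covers [B k]: their limsup is a measurable null set
    containing every [w] that lies in infinitely many [A k]. *)
Lemma borel_cantelli_outer (A : (set T)^nat) (b : nat -> \bar R) :
  (forall k, outer_le (A k) (b k)) -> \sum_(k <oo) b k < +oo ->
  {ae P, forall w, \forall k \near \oo, ~ A k w}.
Proof.
move=> h boo; have /choice[B hB] k : exists C,
  measurable C /\ A k `<=` C /\ P C <= b k.
  by have [C mC [AC PC]] := h k; exists C.
have mB k : measurable (B k) by case: (hB k).
exists (lim_sup_set B); split.
- by apply: bigcap_measurable => // n _; exact: bigcup_measurable.
- apply: lim_sup_set_cvg0 => //; apply: le_lt_trans boo.
  by apply: lee_nneseries => [k _ _|k _]; [exact: measure_ge0|by case: (hB k)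
    => _ []].
- move=> w; apply: contra_notP => nB.
  have [n hn] : exists n, forall j, (n <= j)%N -> ~ B j w.
    apply: contrapT => hn; apply: nB => n _.
    apply: contrapT => hj; apply: hn; exists n => j nj Bj; apply: hj;
      by exists j.
  exists n => // j /= nj Ajw; apply: (hn j nj); by case: (hB j) => _ [+ _];
    exact.
Qed.

End outer_bounds.

Lemma measure_cells (dE : measure_display) (E : measurableType dE) (R :
  realType)
    (mu : {measure set E -> \bar R}) (Q : nat -> set E) (S : set E) :
  (forall k, measurable (Q k)) -> trivIset setT Q -> \bigcup_k Q k = setT ->
  measurable S -> (\sum_(k <oo) mu (Q k `&` S) = mu S)%E.
Proof.
move=> mQ tQ QT mS.
have -> : mu S = mu (\bigcup_k (Q k `&` S)) by rewrite -setI_bigcupl QT setTI.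
rewrite measure_bigcup//; last 2 first.
- by move=> k _; exact: measurableI.
- exact: trivIset_setIr.
by apply: eq_eseriesl => k; rewrite in_setT.
Qed.

Section independent_identically_distributed.
Context (dT : measure_display) (T : measurableType dT) (R : realType)
  (P : probability T R) (dE : measure_display) (E : measurableType dE)
  (X : nat -> {RV P >-> E}) (law : probability E R).
Hypothesis Xindep : mutually_independent X.
Hypothesis Xlaw : forall i B, measurable B -> P (X i @^-1` B) = law B.
Local Open Scope ereal_scope.

Definition rect (J : {fset nat}) (A : nat -> set E) : set T :=
  \bigcap_(j in [set` J]) (X j @^-1` A j).

Lemma measurable_RV_preimage i (B : set E) : measurable B ->
  measurable (X i @^-1` B).
Proof. by move=> mB; rewrite -[X in measurable X]setTI;
  exact: measurable_funP. Qed.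

Lemma measurable_rect J A : (forall j, j \in J -> measurable (A j)) ->
  measurable (rect J A).
Proof.
move=> mA; apply: fin_bigcap_measurable; first exact: finite_fset.
by move=> j jJ; apply: measurable_RV_preimage; exact: mA.
Qed.

Lemma prob_rect J A : (forall j, j \in J -> measurable (A j)) ->
  P (rect J A) = \prod_(j <- J) law (A j).
Proof.
move=> mA; rewrite /rect Xindep//; apply: eq_big_seq => j jJ.
by rewrite Xlaw//; exact: mA.
Qed.

Lemma prob_rect_le (c : R) J A : (forall j, j \in J -> measurable (A j)) ->
  (0 <= c)%R -> (forall j, j \in J -> law (A j) <= c%:E) ->
  P (rect J A) <= (c ^+ #|` J|)%:E.
Proof.
move=> mA c0 Ac; rewrite prob_rect//.
have -> : (c ^+ #|` J|)%:E = \prod_(j <- J) c%:E.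
  by rewrite prodEFin big_const_seq count_predT iter_mulr_1.
have {}Ac : forall j, j \in enum_fset J -> law (A j) <= c%:E by [].
elim: (enum_fset J) Ac => [|j s IHs] h; first by rewrite !big_nil.
rewrite !big_cons; apply: lee_pmul => //.
- by apply: prode_ge0 => *; exact: measure_ge0.
- by apply: h; rewrite inE eqxx.
- by apply: IHs => k ks; apply: h; rewrite inE ks orbT.
Qed.

Lemma rect_fsetU1 i J A B : i \notin J ->
  rect (i |` J)%fset (fun j => if j == i then B else A j) =
  X i @^-1` B `&` rect J A.
Proof.
move=> iJ; apply/seteqP; split => w.
  move=> h; split; first by have := h i; rewrite /= eqxx; apply; exact: fset1U1.
  move=> j /= jJ; have := h j; rewrite /= ifF; first by apply; exact: fset1Ur.
  by apply/negbTE; apply: contraNneq iJ => <-.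
move=> [Bi h] j /=; rewrite in_fset1U; case: eqP => [->//|_ /= jJ]; exact: h.
Qed.

Lemma prob_rectI i J A B : i \notin J -> measurable B ->
  (forall j, j \in J -> measurable (A j)) ->
  P (X i @^-1` B `&` rect J A) = law B * P (rect J A).
Proof.
move=> iJ mB mA; rewrite -rect_fsetU1// !prob_rect//; last first.
  move=> j; rewrite in_fset1U; case: eqP => //= _; exact: mA.
rewrite big_fsetU1//= eqxx; congr (_ * _); apply: eq_big_seq => j jJ.
by rewrite ifF//; apply/negbTE; apply: contraNneq iJ => <-.
Qed.

(** Discretized conditioning on [X i]. If [X i] lies in the cell [Q k] and has no close point, then
    all [X j] avoid [B k]. This event is a rectangle, of probability at most [law (Q k)] restricted
    to [S] times [(1 - p k) ^ #|J|], and the cells are summed. *)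
Lemma void_cells (close : E -> E -> Prop) (S : set E) (Q B : nat -> set E)
    (p : nat -> R) i (J : {fset nat}) :
  measurable S -> (forall k, measurable (Q k)) -> \bigcup_k Q k = setT ->
  (forall k, measurable (B k)) ->
  (forall k x y, Q k x -> S x -> B k y -> close x y) ->
  (forall k, (Q k `&` S) !=set0 -> (p k)%:E <= law (B k)) ->
  i \notin J ->
  outer_le P [set w | S (X i w) /\ forall j, j \in J -> ~ close (X i w) (X j w)]
    (\sum_(k <oo) law (Q k `&` S) * (expR (- (#|` J|%:R * p k)))%:E).
Proof.
move=> mS mQ QT mB QB pB iJ.
pose C k := X i @^-1` (Q k `&` S) `&` rect J (fun=> ~` B k).
apply: (@outer_le_sub _ _ _ _ _ (\bigcup_k C k) _ _ _ (lexx _)).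
  move=> w /= [Sw nw]; have : setT (X i w) by [].
  rewrite -QT => -[k _ Qk]; exists k => //; split=> // j /= jJ Bj.
  exact: nw jJ (QB k _ _ Qk Sw Bj).
apply: outer_le_bigcup => k.
have mQS : measurable (Q k `&` S) by exact: measurableI.
have mBC j : j \in J -> measurable (~` B k) by move=> _; exact: measurableC.
have mC : measurable (C k).
  apply: measurableI; first exact: measurable_RV_preimage.
  exact: measurable_rect.
apply: (outer_le_sub _ _ (outer_le_measurable P mC)) => //.
rewrite /C prob_rectI//.
(* [p k] is controlled only on cells that meet [S]; for the others the factor [law] vanishes. *)
have [->|QS0] := eqVneq (Q k `&` S) set0; first by rewrite measure0 !mul0e.
apply: lee_wpmul2l => //.
rewrite -mulrN expRM_natl.
apply: prob_rect_le => //.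
move=> j _; rewrite probability_setC//.
apply: (@le_trans _ _ (1 - (p k)%:E)).
  by rewrite leeB//; apply: pB; exact/set0P.
by rewrite -EFinB lee_fin -[X in (X <= _)%R]/(1 + - p k)%R expR_ge1Dx.
Qed.

Lemma empty_sector (S : set E) (J : {fset nat}) (p : R) : measurable S ->
  p%:E <= law S ->
  outer_le P [set w | forall j, j \in J -> ~ S (X j w)] (expR (- (#|` J|%:R *
    p)))%:E.
Proof.
move=> mS pS.
have mSC j : j \in J -> measurable (~` S) by move=> _; exact: measurableC.
have mC : measurable (rect J (fun=> ~` S)) by exact: measurable_rect.
apply: (outer_le_sub _ _ (outer_le_measurable P mC)) => //.
rewrite -mulrN expRM_natl; apply: prob_rect_le => //.
move=> j _; rewrite probability_setC//.
apply: (@le_trans _ _ (1 - p%:E)); first by rewrite leeB.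
by rewrite -EFinB lee_fin -[X in (X <= _)%R]/(1 + - p)%R expR_ge1Dx.
Qed.


(** * Simultaneous close pairs in disjoint regions *)

Section close_pairs.
Variables (close : E -> E -> Prop) (S N : nat -> set E) (Q : nat -> set E)
  (B : nat -> nat -> set E) (n1 n2 : nat) (s p : R).
Hypothesis mS : forall l, measurable (S l).
Hypothesis mQ : forall k, measurable (Q k).
Hypothesis mB : forall l k, measurable (B l k).
Hypothesis trivQ : trivIset setT Q.
Hypothesis QT : \bigcup_k Q k = setT.
Hypothesis SN : forall l, S l `<=` N l.
Hypothesis BN : forall l k, B l k `<=` N l.
Hypothesis QB : forall l k x y, Q k x -> S l x -> close x y -> B l k y.
Hypothesis s0 : (0 <= s)%R.
Hypothesis p0 : (0 <= p)%R.
Hypothesis lawS : forall l, law (S l) <= s%:E.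
Hypothesis lawB : forall l k, law (B l k) <= p%:E.

(** The two index ranges differ because, within a dyadic block, the neighbor may have an index
    beyond the range of the first point. *)
Definition close_pair l : set T := [set w | exists i j,
  [/\ (i < n1)%N, (j < n2)%N & [/\ i != j, S l (X i w) & close (X i w) (X j
    w)]]].

Let sum_cells l : \sum_(k <oo) law (Q k `&` S l) <= s%:E.
Proof. by rewrite measure_cells//; exact: lawS. Qed.

(* The points of a close pair lie in [N l]. As the [N l] are disjoint, pairs
   for different [l] have no index in common, and their events factor. *)
Lemma close_pairs_rect m J A : trivIset [set l | (l < m)%N] N ->
  (forall j, j \in J -> measurable (A j)) ->
  (forall j l, j \in J -> (l < m)%N -> A j `&` N l = set0) ->
  outer_le P (rect J A `&` [set w | forall l, (l < m)%N -> close_pair l w])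
    (P (rect J A) * (((n1 * n2)%:R * (s * p)) ^+ m)%:E).
Proof.
elim: m J A => [|m IHm] J A tN mA AN.
  rewrite expr0 mule1; apply: (outer_le_sub _ _ (outer_le_measurable P
    (measurable_rect mA))) => //.
set c := ((n1 * n2)%:R * (s * p))%R in IHm *.
have c0 : (0 <= c)%R by rewrite !mulr_ge0.
(* Fixes the indices of the pair for region [m] and the cell of its first point. The second point is
   relaxed to lie in [B m k], so that the pair only adds two sides to the rectangle. *)
pose U i j k := (rect J A `&` (X i @^-1` (Q k `&` S m) `&` X j @^-1` (B m k))
  `&`
  [set w | i <> j]) `&` [set w | forall l, (l < m)%N -> close_pair l w].
have Ub i j k : outer_le P (U i j k)
    (P (rect J A) * (p * c ^+ m)%:E * law (Q k `&` S m)).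
  have b0 : 0 <= P (rect J A) * (p * c ^+ m)%:E * law (Q k `&` S m).
    by rewrite !mule_ge0// lee_fin mulr_ge0// exprn_ge0.
  have [ij|ij] := eqVneq i j.
    by rewrite (_ : U i j k = set0); [exact: outer_le_set0|apply/seteqP;
      split => // w [[_ /=]]].
  (* An index already used by the rectangle cannot occur again, since its side misses [N m];
     likewise for [j] below. *)
  have [iJ|iJ] := boolP (i \in J).
    rewrite (_ : U i j k = set0); first exact: outer_le_set0.
    apply/seteqP; split => // w [[[rw [[_ Sw] _]] _] _].
    suff : (A i `&` N m) (X i w) by rewrite AN.
    by split; [exact: rw|exact: SN].
  have [jJ|jJ] := boolP (j \in J).
    rewrite (_ : U i j k = set0); first exact: outer_le_set0.
    apply/seteqP; split => // w [[[rw [_ Bw]] _] _].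
    suff : (A j `&` N m) (X j w) by rewrite AN.
    by split; [exact: rw|exact: BN Bw].
  pose A1 h := if h == j then B m k else A h.
  pose A2 h := if h == i then Q k `&` S m else A1 h.
  have iJ1 : i \notin (j |` J)%fset by rewrite in_fset1U negb_or ij.
  have mQS : measurable (Q k `&` S m) by exact: measurableI.
  have mA1 h : h \in (j |` J)%fset -> measurable (A1 h).
    by rewrite /A1 in_fset1U; case: eqP => //= _; exact: mA.
  have mA2 h : h \in (i |` (j |` J))%fset -> measurable (A2 h).
    by rewrite /A2 in_fset1U; case: eqP => //= _; exact: mA1.
  have rE : rect (i |` (j |` J))%fset A2 =
      X i @^-1` (Q k `&` S m) `&` (X j @^-1` (B m k) `&` rect J A).
    by rewrite rect_fsetU1// rect_fsetU1.
  have NN l : (l < m)%N -> N m `&` N l = set0.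
    move=> lm; apply/eqP/negPn/negP => /set0P NN0.
    have := tN m l (ltnSn m) (ltnW lm) NN0; move=> ml; by rewrite ml ltnn in lm.
  have A2N h l : h \in (i |` (j |` J))%fset -> (l < m)%N -> A2 h `&` N l = set0.
    move=> + lm; rewrite /A2 /A1 !in_fset1U; case: eqP => [_ _|_].
      by apply: subsetI_eq0 (NN l lm) => // x [_]; exact: SN.
    case: eqP => [_ _|_ /= hJ]; first exact: subsetI_eq0 (NN l lm).
    by apply: AN => //; exact: ltnW.
  have tN' : trivIset [set l | (l < m)%N] N.
    by apply: sub_trivIset tN => l /= /ltnW.
  (* The remaining [m] pairs are handled by the induction hypothesis for the enlarged rectangle,
     whose probability then splits off the factors of [i] and [j]. *)
  apply: outer_le_sub (IHm _ _ tN' mA2 A2N).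
    rewrite rE => w [[[rw [Qw Bw]] _] hw]; split=> //.
  rewrite rE setIA [X in P X * _](_ : _ = X i @^-1` (Q k `&` S m) `&` (X j
    @^-1` B m k `&` rect J A)); last by rewrite setIA.
  rewrite -(rect_fsetU1 A (B m k) jJ) prob_rectI// rect_fsetU1// prob_rectI//.
  rewrite EFinM [leRHS]muleC (muleA (P _)) (muleC (P _) p%:E) [leRHS]muleA.
  apply: lee_wpmul2r; first by rewrite lee_fin exprn_ge0.
  by apply: lee_wpmul2l => //; exact: lee_wpmul2r.
(* The bound [p] does not depend on the cell, so summing over the infinitely many cells only
   restores [law (S m)]. *)
have Vb i j : outer_le P (\bigcup_k U i j k) (P (rect J A) * (s * p * c ^+
  m)%:E).
  apply: outer_le_sub (outer_le_bigcup (Ub i j)) => //.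
  have rfin : P (rect J A) \is a fin_num by rewrite fin_num_measure//;
    exact: measurable_rect.
  rewrite -(fineK rfin) -EFinM nneseriesZl//.
  rewrite EFinM -muleA fineK//; apply: lee_wpmul2l => //.
  have -> : (s * p * c ^+ m)%:E = (p * c ^+ m)%:E * s%:E by rewrite -EFinM;
    congr EFin; ring.
  apply: lee_wpmul2l; last exact: sum_cells.
  by rewrite lee_fin mulr_ge0// exprn_ge0.
have b0 : 0 <= P (rect J A) * (s * p * c ^+ m)%:E.
  by rewrite mule_ge0// lee_fin !mulr_ge0// exprn_ge0.
have b1 : 0 <= n2%:R%:E * (P (rect J A) * (s * p * c ^+ m)%:E).
  by rewrite mule_ge0// lee_fin.
have := @outer_le_bigcup_ord _ _ _ P n1 (fun i => [set w | exists2 j,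
  (j < n2)%N &
  (\bigcup_k U i j k) w]) _ b1 (fun i _ => outer_le_bigcup_ord b0 (fun j _ =>
    Vb i j)).
apply: outer_le_sub.
  move=> w [rw /= hw].
  have [i [j [i1 j2 [ij Sw cl]]]] := hw m (ltnSn m).
  exists i => //; exists j => //.
  have : setT (X i w) by [].
  rewrite -QT => -[k _ Qk]; exists k => //; split; last by move=> l lm;
    apply: hw; exact: ltnW.
  by split; [split=> //; split=> //; exact: QB cl|exact/eqP].
rewrite !muleA muleC !muleA [leLHS]muleC; apply: lee_wpmul2l => //.
rewrite -!EFinM lee_fin exprS /c natrM; lra.
Qed.

Lemma close_pairs m : trivIset [set l | (l < m)%N] N ->
  outer_le P [set w | forall l, (l < m)%N -> close_pair l w]
    (((n1 * n2)%:R * (s * p)) ^+ m)%:E.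
Proof.
move=> tN; have := @close_pairs_rect m fset0 (fun=> setT) tN.
rewrite (_ : rect _ _ = setT); last by apply/seteqP; split.
by rewrite setTI probability_setT mul1e; apply.
Qed.

End close_pairs.

End independent_identically_distributed.

(** * Cells and density bounds *)

(** The grid of half-open cubes of side [e], numbered by encoding the integer parts of the
    coordinates. Numbers that encode no tuple give empty cells. *)
Lemma cells_exist (R : realType) (d : nat) (h : R) : 0 < h ->
  exists Q : nat -> set (Rtuple R d), [/\ forall k, measurable (Q k),
    trivIset setT Q, \bigcup_k Q k = setT &
    forall k x y, Q k x -> Q k y -> edist x y <= h].
Proof.
move=> h0.
have [e e0 de] : exists2 e, 0 < e & d%:R * e <= h.
  (* The successor avoids a division by zero in dimension 0. *)
  exists (h / d.+1%:R); first by rewrite divr_gt0.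
  by rewrite mulrCA ler_piMr ?(ltW h0)// ler_pdivrMr// mul1r ler_nat.
pose g (x : Rtuple R d) : d.-tuple int := [tuple Num.floor (tnth x i / e) | i <
  d].
exists (fun k => [set x | @choice.pickle (d.-tuple int) (g x) = k]); split.
- move=> k; case E : (@choice.unpickle (d.-tuple int) k) => [t|]; last first.
    rewrite (_ : [set _ | _] = set0)//; apply/seteqP; split => // x /= gk.
    by move: E; rewrite -gk choice.pickleK.
  have [tk|tk] := eqVneq (@choice.pickle (d.-tuple int) t) k; last first.
    rewrite (_ : [set _ | _] = set0)//; apply/seteqP; split => // x /= gk.
    by move: E tk; rewrite -gk choice.pickleK => -[->]; rewrite eqxx.
  rewrite (_ : [set _ | _] = [set x | forall i,
      (`[(tnth t i)%:~R * e, (tnth t i + 1)%:~R * e[%classic : set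
        (measurableTypeR R)) (tnth x i)]).
    apply: (measurable_box (A := fun i => `[(tnth t i)%:~R * e,
      (tnth t i + 1)%:~R * e[%classic)) => i.
    exact: measurable_itv.
  have iff x : (@choice.pickle (d.-tuple int) (g x) = k) <-> g x = t.
    by rewrite -tk; split => [/(pcan_inj choice.pickleK)|->].
  apply/seteqP; split => x /=.
    move=> /iff gt i; rewrite in_itv/= -ler_pdivlMr// -ltr_pdivrMr//.
    by rewrite -gt tnth_mktuple floor_le floorD1_gt.
  move=> H; apply/iff; apply: eq_from_tnth => i; rewrite tnth_mktuple.
  apply/eqP; rewrite floor_eq; have := H i.
  by rewrite in_itv/= -ler_pdivlMr// -ltr_pdivrMr.
- by move=> i j _ _ [x [/= <- <-]].
- by apply/seteqP; split => // x _; exists (@choice.pickle (d.-tuple int) (g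
  x)).
- move=> k x y /= <- /(pcan_inj choice.pickleK) gg.
  apply: (@le_trans _ _ (d%:R * e)).
    apply: edist_le => [|i]; first exact: ltW.
    have : Num.floor (tnth y i / e) = Num.floor (tnth x i / e).
      by have := congr1 (fun t => tnth t i) gg; rewrite !tnth_mktuple.
    have := floor_le (tnth x i / e). have := floorD1_gt (tnth x i / e).
    have := floor_le (tnth y i / e). have := floorD1_gt (tnth y i / e).
    move=> + + + + E; rewrite E; move: (Num.floor _) => z.
    rewrite !ler_pdivlMr// !ltr_pdivrMr// intrD mulrDl mul1r => *.
    by rewrite ler_norml; apply/andP; split; lra.
  exact: de.
Qed.

Section exponential_power_law.
Context (R : realType) (d : nat) (lambda alpha : R).
Variable law : probability (Rtuple R d) R.
Local Notation A := (norm_const d lambda alpha).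
Local Notation f := (@exp_power_pdf R d lambda alpha).
Hypothesis lawE : forall B : set (Rtuple R d), measurable B ->
  law B = (\int[lebesgue_tuple R d]_(x in B) (f x)%:E)%E.
Implicit Types (B : set (Rtuple R d)) (x : Rtuple R d).

Definition potential x : R := lambda * enorm x `^ alpha.

Lemma measurable_potential : measurable_fun setT potential.
Proof.
apply: measurable_funM => //.
exact: (measurableT_comp (measurable_powR _)  (@measurable_enorm R d)).
Qed.

Lemma measurable_pdf : measurable_fun setT (f : Rtuple R d -> R).
Proof.
apply: measurable_funM => //; apply: measurableT_comp => //.
by apply: measurable_funN; exact: measurable_potential.
Qed.

Let measurable_pdfE B : measurable_fun B (fun x => (f x)%:E).
Proof.
apply/measurable_EFinP; apply: measurable_funS measurable_pdf => //.
Qed.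

(** Read off from the total mass 1: a nonpositive constant would make the density, hence its
    integral, nonpositive. *)
Lemma norm_const_gt0 : 0 < A.
Proof.
rewrite ltNge; apply/negP => A0.
have : (law setT <= 0)%E.
  rewrite lawE// (eq_integral (fun x => - (- f x)%:E)%E); last first.
    by move=> x _; rewrite -EFinN opprK.
  have Nf0 x : (0 <= (- f x)%:E)%E.
    by rewrite lee_fin oppr_ge0 mulr_le0_ge0// expR_ge0.
  by rewrite integral_ge0N// oppe_le0 integral_ge0.
by rewrite probability_setT lee_fin ler10.
Qed.

Lemma pdf_ge0 x : 0 <= f x.
Proof. by rewrite mulr_ge0 ?expR_ge0// ltW// norm_const_gt0. Qed.

Lemma law_le B (M : R) : measurable B -> 0 <= M -> (forall x, B x ->
  f x <= M) ->
  (law B <= M%:E * lebesgue_tuple R d B)%E.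
Proof.
move=> mB M0 fM; rewrite lawE// -integral_cst//; apply: ge0_le_integral => //.
by move=> x _; rewrite lee_fin pdf_ge0.
Qed.

Lemma law_ge B (m : R) : measurable B -> 0 <= m -> (forall x, B x ->
  m <= f x) ->
  (m%:E * lebesgue_tuple R d B <= law B)%E.
Proof.
move=> mB m0 fm; rewrite lawE// -integral_cst//; apply: ge0_le_integral => //.
Qed.

(* Comparison of [f] with the dilated density [x |-> f (s x)], whose
   exponent is [s^alpha] times that of [f]. *)
Lemma law_tail B (K s : R) : measurable B -> 0 < s -> s `^ alpha <= 1 ->
  (forall x, B x -> K <= potential x) ->
  (law B <= (expR (- ((1 - s `^ alpha) * K)) * s^-1 ^+ d)%:E)%E.
Proof.
move=> mB s0 s1 KB.
have mfs : measurable_fun setT (fun x : Rtuple R d => (f (tscale s x))%:E).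
  apply/measurable_EFinP; apply: (measurableT_comp measurable_pdf).
  exact: measurable_tscale.
have mcfs (c : R) : measurable_fun setT (fun x : Rtuple R d => (c%:E * (f
  (tscale s x))%:E)%E).
  by apply: emeasurable_funM => //.
set c := expR (- ((1 - s `^ alpha) * K)).
apply: (@le_trans _ _ (\int[lebesgue_tuple R d]_(x in B) (c%:E * (f (tscale s
  x))%:E))%E).
  rewrite (lawE mB); apply: ge0_le_integral.
  - exact: mB.
  - by move=> x _; rewrite lee_fin pdf_ge0.
  - exact: measurable_pdfE.
  - exact: measurable_funS (mcfs c).
  - move=> x Bx; rewrite -EFinM lee_fin /exp_power_pdf mulrCA.
    apply: ler_wpM2l; first exact/ltW/norm_const_gt0.
    rewrite -expRD ler_expR enormZ (gtr0_norm s0) powRM ?enorm_ge0 ?(ltW s0)//.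
    rewrite mulrCA -/(potential x).
    have := ler_wpM2l (_ : 0 <= 1 - s `^ alpha) (KB x Bx).
    by rewrite subr_ge0 => /(_ s1); lra.
(* Once the factor [c] is out, [B] may be enlarged to the whole space, where the change of variables
   turns the dilated density into [s^-1 ^+ d] times the total mass. *)
apply: (@le_trans _ _ (\int[lebesgue_tuple R d]_x (c%:E * (f (tscale s
  x))%:E))%E).
  apply: ge0_subset_integral => // x _.
  by rewrite -EFinM lee_fin mulr_ge0 ?expR_ge0 ?pdf_ge0.
rewrite ge0_integralZl//; last 2 first.
- by move=> x _; rewrite lee_fin pdf_ge0.
- by rewrite lee_fin expR_ge0.
rewrite EFinM; apply: lee_wpmul2l; first by rewrite lee_fin expR_ge0.
pose mu := lebesgue_tuple R d.
have -> : (\int[lebesgue_tuple R d]_x (f (tscale s x))%:E =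
    \int[pushforward mu (tscale s)]_x (f x)%:E)%E.
  rewrite [RHS](ge0_integral_pushforward (@measurable_tscale R d s)).
  - by rewrite preimage_setT.
  - exact: measurableT.
  - exact: measurable_pdfE.
  - by move=> x _; rewrite lee_fin pdf_ge0.
have sd0 : 0 <= s^-1 ^+ d by rewrite exprn_ge0// invr_ge0 ltW.
have -> : (\int[pushforward mu (tscale s)]_x (f x)%:E =
    \int[mscale (NngNum sd0) mu]_x (f x)%:E)%E.
  apply: (@eq_measure_integral _ _ _ _ _
    (measure_function_pushforward__canonical__measure_function_Measure
       mu (@measurable_tscale R d s))) => C mC _.
  by rewrite /= /pushforward/= /mscale/= -lebesgue_tupleZ.
rewrite ge0_integral_mscale; last 3 first.
- exact: measurableT.
- exact: measurable_pdfE.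
- by move=> x _; rewrite lee_fin pdf_ge0.
by rewrite -(lawE measurableT) probability_setT mule1.
Qed.

End exponential_power_law.

(** * Growth estimates *)

Section growth.
Context (R : realType).
Implicit Types (p c C x z : R) (eta delta : R).

Lemma powR_increment p eta : 0 < eta -> exists2 delta, 0 < delta <= 2^-1 &
  forall z x, 1 - delta <= z -> z <= x -> x <= 1 + delta ->
    `|x `^ p - z `^ p - p * (x - z)| <= eta * (x - z).
Proof.
move=> eta0.
have : (fun x : R => p * x `^ (p - 1)) x @[x --> (1 : R)] --> p * 1 `^ (p - 1).
  have h : {for (1 : R), continuous (fun x : R => x `^ (p - 1))}.
    apply: differentiable_continuous; apply/derivable1_diffP.
    by apply: derivable_powR; rewrite in_itv/= andbT.
  by apply: cvgM; [exact: cvg_cst|exact: h].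
rewrite powR1 mulr1 => /cvgrPdist_le /(_ eta eta0) /nbhs_ballP[/= e e0 he].
exists (Num.min (e / 2) 2^-1).
  by rewrite lt_min ge_min lexx orbT andbT divr_gt0//= invr_gt0.
move=> z x z1 zx x1.
have ze : 1 - e / 2 <= z by apply: le_trans z1;
  rewrite lerD2l lerN2 ge_min lexx.
have xe : x <= 1 + e / 2 by apply: (le_trans x1); rewrite lerD2l ge_min lexx.
have z0 : 0 < z.
  apply: lt_le_trans z1; rewrite subr_gt0; apply: (@le_lt_trans _ _ 2^-1).
    by rewrite ge_min lexx orbT.
  by rewrite invf_lt1// ltr1n.
have [c] : exists2 c, c \in `[z, x]%R & x `^ p - z `^ p =
  (p * c `^ (p - 1)) * (x - z).
  apply: (@MVT_segment _ (fun x => x `^ p) (fun x => p * x `^ (p - 1))) => //.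
    move=> y; rewrite in_itv/= => /andP[zy _]; apply: is_derive1_powR.
    exact: lt_trans zy.
  apply: derivable_within_continuous => y; rewrite in_itv/= => /andP[zy _].
  by apply: derivable_powR; rewrite in_itv/= andbT (lt_le_trans z0).
rewrite in_itv/= => /andP[zc cx] ->.
rewrite -mulrBl normrM (ger0_norm (_ : 0 <= x - z)) ?subr_ge0//.
apply: ler_wpM2r; first by rewrite subr_ge0.
rewrite distrC; apply: he; rewrite /ball/=.
by rewrite ltr_norml; apply/andP; split; lra.
Qed.

Lemma near_ln_ge c : \forall L \near +oo, c <= ln (L : R).
Proof.
near=> L; have L0 : 0 < L by near: L; exact: nbhs_pinfty_gt.
rewrite -ler_expR lnK//; near: L; exact: nbhs_pinfty_ge.
Unshelve. all: end_near. Qed.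

Lemma powR_expR_ln c L : 0 < L -> L `^ c = expR (c * ln L).
Proof. by move=> L0; rewrite /powR gt_eqF. Qed.

Lemma near_polyln_le n eta : 0 < eta ->
  \forall L \near +oo, ln (L : R) ^+ n <= expR (eta * ln L).
Proof.
move=> eta0; case: n => [|n].
  near=> L; have y0 : 0 <= ln L by near: L; exact: near_ln_ge.
  by rewrite expr0 -[leLHS]expR0 ler_expR mulr_ge0// ltW.
set m : R := n.+1%:R.
have m0 : 0 < m by [].
near=> L.
have y1 : (2 * m / eta) ^+ 2 <= ln L by near: L; exact: near_ln_ge.
have y0 : 0 <= ln L by apply: le_trans y1; exact: sqr_ge0.
set y := ln L in y0 y1 *.
(* The exponential is a power [2 m] of [expR (eta * y / (2 * m))], which is at least its exponent;
   the square of that exponent exceeds [y] as soon as [y] is at least [(2 * m / eta) ^+ 2]. *)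
have -> : eta * y = (2 * n.+1)%:R * (eta * y / (2 * m)).
  by rewrite natrM -/m; field; rewrite gt_eqF.
rewrite expRM_natl exprM; apply: lerXn2r; rewrite ?nnegrE ?exprn_ge0
  ?expR_ge0//.
have h : eta * y / (2 * m) <= expR (eta * y / (2 * m)).
  by apply: le_trans (expR_ge1Dx _); rewrite lerDr.
apply: (@le_trans _ _ ((eta * y / (2 * m)) ^+ 2)); last first.
  by rewrite lerXn2r ?nnegrE ?expR_ge0// !mulr_ge0 ?invr_ge0 ?mulr_ge0// ltW.
have -> : (eta * y / (2 * m)) ^+ 2 = y * (y / (2 * m / eta) ^+ 2).
  by field; rewrite !gt_eqF.
apply: ler_peMr => //; rewrite ler_pdivlMr ?mul1r//.
by rewrite exprn_gt0// divr_gt0// mulr_gt0.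
Unshelve. all: end_near. Qed.

Lemma near_ln_div eta : 0 < eta ->
  \forall L \near +oo, 0 < ln (L : R) / L <= eta.
Proof.
move=> eta0; near=> L.
have L0 : 0 < L by near: L; exact: nbhs_pinfty_gt.
have l1 : 1 <= ln L by near: L; exact: near_ln_ge.
have l2 : eta^-1 <= ln L by near: L; exact: near_ln_ge.
have l3 : ln L ^+ 2 <= expR (1 * ln L) by near: L; exact: near_polyln_le.
have y0 : 0 < ln L by exact: lt_le_trans l1.
rewrite divr_gt0//= ler_pdivrMr//.
move: l3; rewrite mul1r lnK// => l3.
apply: (@le_trans _ _ (eta * (ln L) ^+ 2)); last by rewrite ler_wpM2l// ltW.
rewrite expr2 mulrA ler_peMl ?(ltW y0)// -(mulfV (lt0r_neq0 eta0)).
by rewrite ler_wpM2l// ltW.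
Unshelve. all: end_near. Qed.

(** Powers [L^c] are written [expR (c * ln L)], so that products become sums of exponents. A
    positive gap between exponents absorbs any constant. *)
Lemma near_const_le C c1 c2 : c2 < c1 ->
  \forall L \near +oo, C * expR (c2 * ln (L : R)) <= expR (c1 * ln L).
Proof.
move=> c12; near=> L.
have -> : c1 * ln L = (c1 - c2) * ln L + c2 * ln L by ring.
rewrite expRD ler_wpM2r ?expR_ge0//.
have d0 : 0 < c1 - c2 by rewrite subr_gt0.
have h : C / (c1 - c2) <= ln L by near: L; exact: near_ln_ge.
apply: le_trans (expR_ge1Dx _).
move: h; rewrite ler_pdivrMr// mulrC; lra.
Unshelve. all: end_near. Qed.

Lemma near_polyln_expR n C c1 c2 : 0 <= C -> c2 < c1 ->
  \forall L \near +oo, C * ln (L : R) ^+ n * expR (c2 * ln L) <=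
    expR (c1 * ln L).
Proof.
move=> C0 c12; have e0 : 0 < (c1 - c2) / 2 by rewrite divr_gt0// subr_gt0.
near=> L.
apply: (@le_trans _ _ (C * expR (((c1 + c2) / 2) * ln L))); last first.
  near: L; apply: near_const_le; lra.
rewrite -mulrA ler_wpM2l//.
have -> : (c1 + c2) / 2 * ln L = (c1 - c2) / 2 * ln L + c2 * ln L by field.
rewrite expRD ler_wpM2r ?expR_ge0//.
near: L; exact: near_polyln_le.
Unshelve. all: end_near. Qed.

End growth.

(** * Shells *)

Section shells.
Context (R : realType) (d : nat) (lambda alpha : R).
Hypothesis lambda0 : 0 < lambda.
Hypothesis alpha0 : 0 < alpha.
Implicit Types (a b c s q L eta kappa : R).

Definition eps L : R := ln L / L.

Definition rad L : R := (L / lambda) `^ alpha^-1.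

(* The radius at which [lambda * t `^ alpha = L + s * ln L]. *)
Definition shell s L : R := rad L * (1 + s * eps L) `^ alpha^-1.

Lemma near_eps eta : 0 < eta -> \forall L \near +oo, 0 < eps L <= eta.
Proof. exact: near_ln_div. Qed.

Lemma near_eps_mul c eta : 0 < eta -> \forall L \near +oo, `|c * eps L| <= eta.
Proof.
move=> eta0; have e0 : 0 < eta / (`|c| + 1) by rewrite divr_gt0// ltr_wpDl.
near=> L.
have /andP[e1 e2] : 0 < eps L <= eta / (`|c| + 1) by near: L; exact: near_eps.
rewrite normrM (gtr0_norm e1); move: e2; rewrite ler_pdivlMr ?ltr_wpDl// => e2.
apply: le_trans e2; rewrite mulrC ler_wpM2l ?(ltW e1)//; lra.
Unshelve. all: end_near. Qed.

Lemma near_powR_one p s eta : 0 < eta ->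
  \forall L \near +oo, `|(1 + s * eps L) `^ p - 1| <= eta.
Proof.
move=> eta0; have [dl /andP[dl0 _] H] := @powR_increment R p 1 ltr01.
near=> L.
have e1 : `|s * eps L| <= dl by near: L; exact: near_eps_mul.
have : `|((`|p| + 1) * s) * eps L| <= eta by near: L; exact: near_eps_mul.
rewrite -mulrA normrM (ger0_norm (_ : 0 <= `|p| + 1)); last by rewrite addr_ge0.
set t := s * eps L in e1 *; move: e1; rewrite ler_norml => /andP[t1 t2].
apply: le_trans; have [t0|t0] := leP 0 t.
  have := H 1 (1 + t); rewrite powR1 lerD2l lerBlDr lerDl lerDl => /(_ (ltW
    dl0) t0 t2).
  rewrite (_ : 1 + t - 1 = t); last by ring.
  move=> h; rewrite (_ : (1 + t) `^ p - 1 = ((1 + t) `^ p - 1 - p * t) +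
    p * t); last by ring.
  apply: le_trans (ler_normD _ _) _; rewrite normrM (ger0_norm t0); lra.
have := H (1 + t) 1; rewrite powR1 lerD2l lerDl gerDl => /(_ _ (ltW t0) (ltW
  dl0)).
rewrite (_ : 1 - (1 + t) = - t); last by ring.
rewrite -lerNl => /(_ _); rewrite lerNl => /(_ t1) h.
rewrite (_ : (1 + t) `^ p - 1 = - (1 - (1 + t) `^ p - p * (- t)) + p * t);
  last by ring.
apply: le_trans (ler_normD _ _) _; rewrite normrN normrM (ltr0_norm t0); lra.
Unshelve. all: end_near. Qed.

Lemma rad_gt0 L : 0 < L -> 0 < rad L.
Proof. by move=> L0; rewrite powR_gt0// divr_gt0. Qed.

Lemma rad_alpha L : 0 < L -> lambda * rad L `^ alpha = L.
Proof.
move=> L0; have Ll : 0 < L / lambda by rewrite divr_gt0.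
rewrite -powRrM mulVf ?gt_eqF// powRr1 ?(ltW Ll)//.
by rewrite mulrC divfK// gt_eqF.
Qed.

Lemma rad_exp L : 0 < L ->
  rad L ^+ d = lambda `^ (- (d%:R / alpha)) * expR (d%:R / alpha * ln L).
Proof.
move=> L0; have Ll : 0 < L / lambda by rewrite divr_gt0.
rewrite -powR_mulrn ?(ltW (rad_gt0 L0))// -powRrM.
rewrite !powR_expR_ln// ln_div ?posrE// -expRD; congr expR; field.
by rewrite gt_eqF.
Qed.

Lemma eps_exp n L : 0 < L -> eps L ^+ n = ln L ^+ n * expR (- (n%:R * ln L)).
Proof.
move=> L0; rewrite /eps expr_div_n; congr (_ * _).
by rewrite expRN expRM_natl lnK.
Qed.

Lemma shell_potential s L : 0 < L -> 0 <= 1 + s * eps L ->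
  lambda * shell s L `^ alpha = L + s * ln L.
Proof.
move=> L0 s0; rewrite /shell powRM ?powR_ge0//.
rewrite mulrA rad_alpha// -powRrM mulVf ?gt_eqF// powRr1//.
by rewrite /eps; field; rewrite gt_eqF.
Qed.

Lemma near_shell_ratio s eta : 0 < eta ->
  \forall L \near +oo, (1 - eta) * rad L <= shell s L <= (1 + eta) * rad L.
Proof.
move=> eta0; near=> L.
have L0 : 0 < L by near: L; exact: nbhs_pinfty_gt.
have : `|(1 + s * eps L) `^ alpha^-1 - 1| <= eta by near: L;
  exact: near_powR_one.
rewrite ler_norml => /andP[h1 h2]; have r0 := rad_gt0 L0.
by rewrite /shell; apply/andP; split; rewrite (mulrC (rad L)) ler_pM2r//; lra.
Unshelve. all: end_near. Qed.

Lemma near_potential_drop a b q k1 k2 : 0 < q -> k1 < alpha * q ->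
  alpha * q < k2 ->
  \forall L \near +oo, forall t, shell a L <= t <= shell b L ->
    k1 * ln L <= lambda * t `^ alpha - lambda * (t - q * eps L * rad L) `^
      alpha <= k2 * ln L.
Proof.
move=> q0 k1q k2q.
(* Divided by [q] so that the error [eta * (q * eps L)] is exactly the available slack times
   [eps L]. *)
pose eta := Num.min (alpha * q - k1) (k2 - alpha * q) / q.
have eta0 : 0 < eta by rewrite divr_gt0// lt_min !subr_gt0 k1q.
have [dl /andP[dl0 dl1] H] := powR_increment alpha eta0.
have dl2 : 0 < dl / 2 by rewrite divr_gt0.
near=> L => t /andP[at_ tb].
have L0 : 0 < L by near: L; exact: nbhs_pinfty_gt.
have /andP[ha _] : (1 - dl / 2) * rad L <= shell a L <= (1 + dl / 2) * rad L.
  by near: L; exact: near_shell_ratio.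
have /andP[_ hb] : (1 - dl / 2) * rad L <= shell b L <= (1 + dl / 2) * rad L.
  by near: L; exact: near_shell_ratio.
have /andP[e0 _] : 0 < eps L <= 1 by near: L; exact: near_eps.
have : `|q * eps L| <= dl / 2 by near: L; exact: near_eps_mul.
have qe0 : 0 < q * eps L by rewrite mulr_gt0.
rewrite gtr0_norm// => qe.
have r0 := rad_gt0 L0.
have [x tE] : exists x, t = rad L * x by exists (t / rad L);
  rewrite mulrC divfK// gt_eqF.
have x1 : 1 - dl / 2 <= x by rewrite -(ler_pM2l r0) -tE mulrC (le_trans ha).
have x2 : x <= 1 + dl / 2 by rewrite -(ler_pM2l r0) -tE (le_trans tb)// mulrC.
have [z z_def] : exists z, z = x - q * eps L by exists (x - q * eps L).
have zE : t - q * eps L * rad L = rad L * z by rewrite tE z_def; ring.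
have z0 : 0 <= z by rewrite z_def; lra.
have x0 : 0 <= x by lra.
rewrite zE tE !powRM ?(ltW r0)// !mulrA rad_alpha// -mulrBr.
have := H z x; rewrite {1 2}z_def.
have -> : x - z = q * eps L by rewrite z_def; ring.
have h1 : 1 - dl <= x - q * eps L by lra.
have h2 : x - q * eps L <= x by lra.
have h3 : x <= 1 + dl by lra.
move=> /(_ h1 h2 h3); rewrite ler_norml => /andP[h4 h5].
have lnE : ln L = L * eps L by rewrite /eps mulrC divfK// gt_eqF.
have etaq : eta * (q * eps L) = Num.min (alpha * q - k1) (k2 - alpha * q) * eps
  L.
  by rewrite /eta mulrA divfK// gt_eqF.
rewrite etaq in h4 h5.
have m1 : Num.min (alpha * q - k1) (k2 - alpha * q) * eps L <=
  (alpha * q - k1) * eps L.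
  by rewrite ler_pM2r// ge_min lexx.
have m2 : Num.min (alpha * q - k1) (k2 - alpha * q) * eps L <=
  (k2 - alpha * q) * eps L.
  by rewrite ler_pM2r// ge_min lexx orbT.
rewrite lnE mulrCA (mulrCA k2) !ler_pM2l//; apply/andP; split; lra.
Unshelve. all: end_near. Qed.

(** The same linearization with exponent [d / alpha], as [shell s L ^+ d] is [rad L ^+ d] times that
    power of [1 + s * eps L]. *)
Lemma near_shell_volume a b k1 k2 : a < b ->
  k1 < d%:R / alpha * (b - a) -> d%:R / alpha * (b - a) < k2 ->
  \forall L \near +oo, k1 * eps L * rad L ^+ d <=
    shell b L ^+ d - shell a L ^+ d <= k2 * eps L * rad L ^+ d.
Proof.
move=> ab k1q k2q; set p := d%:R / alpha in k1q k2q *.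
have ba0 : 0 < b - a by rewrite subr_gt0.
pose m := Num.min (p * (b - a) - k1) (k2 - p * (b - a)).
have eta0 : 0 < m / (b - a) by rewrite divr_gt0// /m lt_min !subr_gt0 k1q.
have [dl /andP[dl0 dl1] H] := powR_increment p eta0.
near=> L.
have L0 : 0 < L by near: L; exact: nbhs_pinfty_gt.
have /andP[e0 _] : 0 < eps L <= 1 by near: L; exact: near_eps.
have : `|a * eps L| <= dl by near: L; exact: near_eps_mul.
rewrite ler_norml => /andP[a1 a2].
have : `|b * eps L| <= dl by near: L; exact: near_eps_mul.
rewrite ler_norml => /andP[b1 b2].
have abe : a * eps L <= b * eps L by rewrite ler_pM2r// ltW.
have r0 := rad_gt0 L0.
have E s : shell s L ^+ d = rad L ^+ d * (1 + s * eps L) `^ p.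
  rewrite /shell exprMn -[in X in _ * X]powR_mulrn ?powR_ge0// -powRrM.
  by congr (_ * _ `^ _); rewrite mulrC.
rewrite !E -mulrBr mulrC (mulrC (k2 * _)) !ler_pM2l ?exprn_gt0//.
have h1 : 1 - dl <= 1 + a * eps L by lra.
have h2 : 1 + a * eps L <= 1 + b * eps L by lra.
have h3 : 1 + b * eps L <= 1 + dl by lra.
have := H _ _ h1 h2 h3.
have -> : 1 + b * eps L - (1 + a * eps L) = (b - a) * eps L by ring.
rewrite ler_norml mulrA divfK ?gt_eqF// => /andP[h4 h5].
have m1 : m * eps L <= (p * (b - a) - k1) * eps L by rewrite ler_pM2r// ge_min
  lexx.
have m2 : m * eps L <= (k2 - p * (b - a)) * eps L by rewrite ler_pM2r// ge_min
  lexx orbT.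
by apply/andP; split; lra.
Unshelve. all: end_near. Qed.

End shells.

(** * Isolation probability *)

Section isolation_probability.
Context (dT : measure_display) (T : measurableType dT) (R : realType)
  (P : probability T R) (d : nat) (lambda alpha : R)
  (X : nat -> {RV P >-> Rtuple R d}) (law : probability (Rtuple R d) R).
Hypothesis d0 : (0 < d)%N.
Hypothesis lambda0 : 0 < lambda.
Hypothesis alpha0 : 0 < alpha.
Hypothesis Xindep : mutually_independent X.
Hypothesis Xlaw : forall i B, measurable B -> P (X i @^-1` B) = law B.
Local Notation A := (norm_const d lambda alpha).
Local Notation f := (@exp_power_pdf R d lambda alpha).
Local Notation mu := (lebesgue_tuple R d).
Hypothesis lawE : forall B : set (Rtuple R d), measurable B ->
  law B = (\int[mu]_(x in B) (f x)%:E)%E.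

Let A0 : 0 < A. Proof. exact: norm_const_gt0 lawE. Qed.

Lemma pdf_le (x : Rtuple R d) (t : R) : 0 <= t -> t <= enorm x ->
  f x <= A * expR (- (lambda * t `^ alpha)).
Proof.
move=> t0 tx; rewrite /exp_power_pdf ler_pM2l// ler_expR lerN2 ler_pM2l//.
by apply: ge0_ler_powR; rewrite ?nnegrE ?enorm_ge0// ltW.
Qed.

Lemma pdf_ge (x : Rtuple R d) (t : R) : enorm x <= t ->
  A * expR (- (lambda * t `^ alpha)) <= f x.
Proof.
move=> xt; rewrite /exp_power_pdf ler_pM2l// ler_expR lerN2 ler_pM2l//.
by apply: ge0_ler_powR; rewrite ?nnegrE ?enorm_ge0 ?(le_trans (enorm_ge0 _)
  xt)// ltW.
Qed.

Section upper.
Variables (delta r : R).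
Hypothesis delta0 : 0 < delta.
Hypothesis delta5 : 5 * delta < 1.
Hypothesis r0 : 0 < r.

Let v : R := (2 * (delta * r / d%:R)) ^+ d.

Let dn0 : 0 < d%:R :> R. Proof. by rewrite ltr0n. Qed.

Let v0 : 0 < v.
Proof. by rewrite exprn_gt0// !mulr_gt0// invr_gt0. Qed.

(** A representative [x0 k] of the cell is pulled toward the origin by [(1 - 3 * delta) * r], and
    [B k] is a cube of Euclidean radius at most [delta * r] around the result. With the cell
    diameter the distances add up to [(1 - delta) * r]. *)
Lemma cell_cubes (S : set (Rtuple R d)) (Q : nat -> set (Rtuple R d)) :
  (forall k x y, Q k x -> Q k y -> edist x y <= delta * r) ->
  exists B : nat -> set (Rtuple R d), exists x0 : nat -> Rtuple R d,
  [/\ forall k, measurable (B k),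
      forall k x z, Q k x -> S x -> B k z -> edist x z <= r &
      forall k, (Q k `&` S) !=set0 ->
        [/\ Q k (x0 k), S (x0 k), mu (B k) = v%:E & forall z, B k z ->
          enorm z <= Num.max 0 (enorm (x0 k) - (1 - 3 * delta) * r) +
            delta * r]].
Proof.
move=> Qdiam.
have /choice[F HF] k : exists Bx : set (Rtuple R d) * Rtuple R d,
  [/\ measurable Bx.1,
      forall x z, Q k x -> S x -> Bx.1 z -> edist x z <= r &
      (Q k `&` S) !=set0 ->
        [/\ Q k Bx.2, S Bx.2, mu Bx.1 = v%:E & forall z, Bx.1 z ->
          enorm z <= Num.max 0 (enorm Bx.2 - (1 - 3 * delta) * r) + delta * r]].
  have [QS|/set0P[x0 [Qx0 Sx0]]] := eqVneq (Q k `&` S) set0.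
    exists (set0, [tuple 0 | _ < d]); split => //=.
    by rewrite QS => -[].
  have t0 : 0 <= (1 - 3 * delta) * r by apply: mulr_ge0; [move: delta0 delta5;
    lra|exact: ltW].
  have [y [xy ny]] := shrink_toward_origin x0 t0.
  have dr0 : 0 <= delta * r / d%:R by rewrite !mulr_ge0// ?invr_ge0 ltW.
  have cy z : cube y (delta * r / d%:R) z -> edist z y <= delta * r.
    move=> yz; apply: le_trans (edist_le dr0 yz) _.
    by rewrite mulrC divfK// gt_eqF.
  exists (cube y (delta * r / d%:R), x0); split => /=.
  - exact: measurable_cube.
  - move=> x z Qx Sx /cy; rewrite edistC => yz.
    apply: le_trans (edist_triangle x0 _ _) _.
    apply: (@le_trans _ _ (delta * r + ((1 - 3 * delta) * r + delta * r))).
      apply: lerD; first exact: (Qdiam k).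
      by apply: le_trans (edist_triangle y _ _) _; exact: lerD.
    by have := mulr_ge0 (ltW delta0) (ltW r0); lra.
  - move=> _; split => //; first exact: lebesgue_tuple_cube.
    by move=> z /cy zy; apply: le_trans (enorm_le_edist z y) _; exact: lerD.
exists (fun k => (F k).1), (fun k => (F k).2).
by split => k; case: (HF k).
Qed.

Variables (rho_a rho_b G s w : R).
Hypothesis rho_a_r : r <= rho_a.
Hypothesis rho_ab : rho_a <= rho_b.
Hypothesis drop : forall t, rho_a <= t <= rho_b ->
  G <= lambda * t `^ alpha - lambda * (t - (1 - 5 * delta) * r) `^ alpha.
Hypothesis s0 : 0 < s.
Hypothesis s1 : s `^ alpha <= 1.
Hypothesis annulus_volume : mu (annulus rho_a rho_b) =
  (w * (rho_b ^+ d - rho_a ^+ d))%:E.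

Variables (i : nat) (J : {fset nat}).
Hypothesis iJ : i \notin J.
Hypothesis J0 : (0 < #|` J|)%N.

Let isolated_in (S : set (Rtuple R d)) : set T := [set z | S (X i z) /\
  forall j, j \in J -> ~ (edist (X i z) (X j z) <= r)].

(** Each test cube stays inside the ball of radius [rho_a], so one lower bound for its mass serves
    all cells, whose total mass is at most 1. *)
Let low_bound : outer_le P (isolated_in (eball rho_a))
  (expR (- (#|` J|%:R * (A * expR (- (lambda * rho_a `^ alpha)) * v))))%:E.
Proof.
have [Q [mQ tQ QT Qdiam]] := @cells_exist R d (delta * r) (mulr_gt0 delta0 r0).
have mS := @measurable_eball R d rho_a.
have [B [x0 [mB QB Bx]]] := cell_cubes (eball rho_a) Qdiam.
set p := A * expR (- (lambda * rho_a `^ alpha)) * v.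
have pB k : (Q k `&` eball rho_a) !=set0 -> (((fun=> p) k)%:E <= law (B k))%E.
  move=> /Bx[Qx0 Sx0 Bv Bn]; rewrite /p EFinM -Bv.
  apply: (law_ge lawE (mB k)); first by rewrite mulr_ge0 ?expR_ge0 ?(ltW A0).
  move=> z /Bn zn; apply: pdf_ge; apply: le_trans zn _.
  rewrite -lerBrDr ge_max; move: Sx0; rewrite /eball/=.
  have : 0 < delta * r by exact: mulr_gt0.
  have : 5 * delta * r < 1 * r by rewrite ltr_pM2r.
  by move: rho_a_r => *; apply/andP; split; lra.
have := void_cells Xindep Xlaw mS mQ QT mB QB pB iJ.
apply: outer_le_sub => //.
rewrite (eq_eseriesr (g := fun k => ((expR (- (#|` J|%:R * p)))%:E * law (Q k
  `&` eball rho_a))%E)); last first.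
  by move=> k _; rewrite muleC.
rewrite nneseriesZl// measure_cells//.
rewrite -[leRHS]mule1; apply: lee_wpmul2l; last exact: probability_le1.
by rewrite lee_fin expR_ge0.
Qed.

(** The density is at most [M k] on the cell and at least [expR G * M k] on its test cube. By
    [exp(- y) <= 1 / y] the factor [M k] cancels, leaving [expR (- G)] times the volume of the
    annulus over [#|J| * v]. *)
Let mid_bound : outer_le P (isolated_in (annulus rho_a rho_b))
  (expR (- G) * (w * (rho_b ^+ d - rho_a ^+ d)) / (#|` J|%:R * v))%:E.
Proof.
have [Q [mQ tQ QT Qdiam]] := @cells_exist R d (delta * r) (mulr_gt0 delta0 r0).
have mS := @measurable_annulus R d rho_a rho_b.
have [B [x0 [mB QB Bx]]] := cell_cubes (annulus rho_a rho_b) Qdiam.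
(* A lower bound for the norm throughout the cell within the annulus. The loss [5 * delta] is three
   for the pull, one for the size of the cube and one for the cell. *)
pose b k := Num.max rho_a (enorm (x0 k) - delta * r).
pose M k := A * expR (- (lambda * b k `^ alpha)).
have M0 k : 0 < M k by rewrite mulr_gt0// expR_gt0.
have dr0 : 0 < delta * r by exact: mulr_gt0.
have dr5 : 5 * delta * r < 1 * r by rewrite ltr_pM2r.
have pB k : (Q k `&` annulus rho_a rho_b) !=set0 ->
    ((expR G * M k * v)%:E <= law (B k))%E.
  move=> /Bx[Qx0 /andP[ax xb] Bv Bn]; rewrite EFinM -Bv.
  apply: (law_ge lawE (mB k)); first by rewrite mulr_ge0 ?expR_ge0 ?(ltW (M0
    k)).
  have bk1 : rho_a <= b k by rewrite le_max lexx.
  have bk2 : b k <= rho_b by rewrite ge_max rho_ab; move: dr0 xb; lra.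
  have bk3 : enorm (x0 k) - delta * r <= b k by rewrite le_max lexx orbT.
  move=> z /Bn zn; apply: le_trans (pdf_ge (t := b k - (1 - 5 * delta) * r) _).
    rewrite mulrCA ler_pM2l// -expRD ler_expR.
    have := drop (t := b k); rewrite bk1 bk2 => /(_ isT); lra.
  apply: le_trans zn _; rewrite -lerBrDr ge_max.
  by move: rho_a_r => *; apply/andP; split; lra.
have lawQ k : (law (Q k `&` annulus rho_a rho_b) <=
  (M k)%:E * mu (Q k `&` annulus rho_a rho_b))%E.
  have [QS|QS] := eqVneq (Q k `&` annulus rho_a rho_b) set0.
    by rewrite QS !measure0 mule0.
  have /set0P/Bx[Qx0 Sx0 Bv Bn] := QS.
  apply: (law_le lawE); [exact: measurableI|exact: ltW|].
  move=> x [Qx /andP[ax xb]]; apply: pdf_le;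
    first by rewrite le_max (le_trans _ rho_a_r)// ltW.
  rewrite ge_max (ltW ax)/= lerBlDr; apply: le_trans (enorm_le_edist _ x) _.
  by rewrite lerD2l; exact: (Qdiam k).
have := void_cells Xindep Xlaw mS mQ QT mB QB pB iJ.
apply: outer_le_sub => //.
set m := #|` J|%:R.
have m0 : 0 < m by rewrite ltr0n.
apply: (@le_trans _ _ (\sum_(k <oo) ((expR (- G) / (m * v))%:E * mu (Q k `&`
  annulus rho_a rho_b)))%E).
  apply: lee_nneseries => [k _ _|k _]; first by rewrite mule_ge0// lee_fin
    expR_ge0.
  apply: (@le_trans _ _ ((M k)%:E * mu (Q k `&` annulus rho_a rho_b) *
     ((m * (expR G * M k * v))^-1)%:E)%E).
    apply: lee_pmul => //.
    have q0 : 0 < m * (expR G * M k * v) by exact: (mulr_gt0 m0 (mulr_gt0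
      (mulr_gt0 (expR_gt0 _) (M0 k)) v0)).
    rewrite lee_fin expRN lef_pV2 ?posrE ?expR_gt0//.
    by apply: le_trans (expR_ge1Dx _); rewrite lerDr.
  rewrite muleAC -EFinM; apply: lee_wpmul2r => //.
  rewrite lee_fin expRN le_eqVlt; apply/orP/or_introl/eqP.
  by field; apply/and4P; split; apply: lt0r_neq0 => //; exact: expR_gt0.
rewrite nneseriesZl// measure_cells// annulus_volume -EFinM lee_fin.
by rewrite mulrAC.
Qed.

Lemma isolated_bound (u_a u_b : R) :
  lambda * rho_a `^ alpha = u_a -> lambda * rho_b `^ alpha = u_b ->
  outer_le P [set z | forall j, j \in J -> ~ (edist (X i z) (X j z) <= r)]
  (expR (- (#|` J|%:R * (A * expR (- u_a) * v))) +
   expR (- G) * (w * (rho_b ^+ d - rho_a ^+ d)) / (#|` J|%:R * v) +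
   expR (- ((1 - s `^ alpha) * u_b)) * s^-1 ^+ d)%:E.
Proof.
move=> <- <-.
have mb : measurable (~` @eball R d rho_b) by apply: measurableC;
  exact: measurable_eball.
have mX : measurable (X i @^-1` ~` eball rho_b) by exact:
  measurable_RV_preimage.
have high : outer_le P (X i @^-1` ~` eball rho_b)
    (expR (- ((1 - s `^ alpha) * (lambda * rho_b `^ alpha))) * s^-1 ^+ d)%:E.
  apply: (outer_le_sub _ _ (outer_le_measurable P mX)) => //.
  rewrite Xlaw//; apply: (law_tail lawE mb s0 s1) => x /= /negP.
  rewrite -ltNge => bx; rewrite ler_pM2l//.
  by apply: ge0_ler_powR; rewrite ?nnegrE ?enorm_ge0 ?(ltW alpha0) ?(ltW bx)//
    (le_trans _ rho_ab)// (le_trans _ rho_a_r)// ltW.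
have := outer_leU (outer_leU low_bound mid_bound) high.
rewrite -!EFinD; apply: outer_le_sub => // z zJ.
have [za|za] := leP (enorm (X i z)) rho_a; first by left; left; split.
have [zb|zb] := leP (enorm (X i z)) rho_b.
  by left; right; split => //; apply/andP.
by right => /=; apply/negP; rewrite -ltNge.
Qed.

End upper.

End isolation_probability.

(** * Upper asymptotics *)

Lemma near_superpoly (R : realType) (c C k : R) : 0 < c -> 0 < C ->
  \forall L \near +oo, C * expR L * expR (- (c * expR (2 * ln L))) <=
    expR (- (k * ln (L : R))).
Proof.
move=> c0 C0.
near=> L.
have L0 : 0 < L by near: L; exact: nbhs_pinfty_gt.
have h1 : (1 + `|k| + `|ln C|) / c * expR (1 * ln L) <= expR (2 * ln L).
  near: L; apply: near_const_le; rewrite ltr1n//.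
have y1 : 1 <= ln L by near: L; exact: near_ln_ge.
rewrite -{1}(@lnK _ C) ?posrE// -!expRD ler_expR.
have h2 : (1 + `|k| + `|ln C|) * L <= c * expR (2 * ln L).
  by move: h1; rewrite mul1r (@lnK _ L)// -ler_pdivrMl// mulrA (mulrC c^-1).
have yL : ln L <= L by rewrite -{2}(@lnK _ L) ?posrE// (le_trans _ (expR_ge1Dx
  _))// lerDr.
have L1 : 1 <= L by exact: le_trans yL.
have h3 : k * ln L <= `|k| * L.
  apply: (@le_trans _ _ (`|k| * ln L)); last by rewrite ler_wpM2l.
  by rewrite ler_wpM2r ?ler_norm// (le_trans _ y1).
have h4 : ln C <= `|ln C| * L.
  by apply: (le_trans (ler_norm _)); rewrite ler_peMr.
move: h2; rewrite !mulrDl mul1r; lra.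
Unshelve. all: end_near. Qed.

Lemma one_plus_ge0 (R : realType) (x : R) : `|x| <= 1 -> 0 <= 1 + x.
Proof. by rewrite ler_norml => /andP[? _]; lra. Qed.

Lemma half_le_pred (R : realType) (x : R) : 4 <= x -> x / 2 <= x - 1.
Proof. lra. Qed.

Section upper_asymptotics.
Context (dT : measure_display) (T : measurableType dT) (R : realType)
  (P : probability T R) (d : nat) (lambda alpha : R)
  (X : nat -> {RV P >-> Rtuple R d}) (law : probability (Rtuple R d) R).
Hypothesis d0 : (0 < d)%N.
Hypothesis lambda0 : 0 < lambda.
Hypothesis alpha0 : 0 < alpha.
Hypothesis Xindep : mutually_independent X.
Hypothesis Xlaw : forall i B, measurable B -> P (X i @^-1` B) = law B.
Local Notation A := (norm_const d lambda alpha).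
Local Notation f := (@exp_power_pdf R d lambda alpha).
Local Notation mu := (lebesgue_tuple R d).
Hypothesis lawE : forall B : set (Rtuple R d), measurable B ->
  law B = (\int[mu]_(x in B) (f x)%:E)%E.

Lemma eps_rad_exp L : 0 < L -> (eps L * rad lambda alpha L) ^+ d =
  lambda `^ (- (d%:R / alpha)) * (ln L ^+ d * expR ((d%:R / alpha - d%:R) * ln
    L)).
Proof.
move=> L0; rewrite exprMn eps_exp// rad_exp// mulrBl expRD.
by ring.
Qed.

(** With this [a], the expected number of points in the test cube is at least of order [L^2], and
    [exp(- c' L^2)] beats the factor [2 * expR L] of the union over indices. *)
Lemma near_low_term (a c : R) : 0 < c -> a = d%:R / alpha - d%:R - 2 ->
  forall k : R, \forall L \near +oo,
  2 * expR L * expR (- (expR L / 2 * (A * expR (- (L + a * ln L)) *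
     (c * (eps L * rad lambda alpha L) ^+ d)))) <= expR (- (k * ln L)).
Proof.
move=> c0 aE k.
have A0 : 0 < A by exact: norm_const_gt0 lawE.
pose c' := A * c * lambda `^ (- (d%:R / alpha)) / 2.
have c'0 : 0 < c' by apply: divr_gt0 => //; exact: (mulr_gt0 (mulr_gt0 A0 c0)
  (powR_gt0 _ lambda0)).
near=> L.
have L0 : 0 < L by near: L; exact: nbhs_pinfty_gt.
have y1 : 1 <= ln L by near: L; exact: near_ln_ge.
apply: (@le_trans _ _ (2 * expR L * expR (- (c' * expR (2 * ln L)))));
  last first.
  by near: L; exact: near_superpoly.
rewrite ler_wpM2l ?mulr_ge0 ?expR_ge0// ler_expR lerN2 eps_rad_exp//.
rewrite [leRHS](_ : _ = c' * (ln L ^+ d * expR (2 * ln L))); last first.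
  have -> : 2 * ln L = - (a * ln L) + (d%:R / alpha - d%:R) * ln L by rewrite
    aE; ring.
  rewrite opprD !expRD [expR (- L)]expRN /c'; field.
  by rewrite gt_eqF ?expR_gt0.
by rewrite ler_pM2l// ler_peMl ?expR_ge0// exprn_ege1.
Unshelve. all: end_near. Qed.

(** The annulus has relative volume [eps L] and the cube [eps L ^+ d]; their ratio costs [L^(d - 1)]
    and brings only harmless powers of [ln L]. This is the term that forces [alpha * q > d]. *)
Lemma near_mid_term (c w K t t' : R) : 0 < c -> 0 <= w -> 0 <= K -> t' < t ->
  \forall L \near +oo,
  2 * expR L * (expR (- ((d%:R + t) * ln L)) *
     (w * (K * eps L * rad lambda alpha L ^+ d)) /
     (expR L / 2 * (c * (eps L * rad lambda alpha L) ^+ d))) <=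
  expR (- ((1 + t') * ln L)).
Proof.
move=> c0 w0 K0 tt.
near=> L.
have L0 : 0 < L by near: L; exact: nbhs_pinfty_gt.
have y1 : 1 <= ln L by near: L; exact: near_ln_ge.
have y0 : 0 < ln L by exact: lt_le_trans y1.
have r0 := @rad_gt0 R lambda alpha lambda0 L L0.
have e0 : 0 < eps L by rewrite divr_gt0.
apply: (@le_trans _ _ (4 * w * K / c * expR (- (1 + t) * ln L))); last first.
  rewrite -mulNr; near: L; apply: near_const_le; lra.
rewrite [leLHS](_ : _ = 4 * w * K / c * (expR (- ((d%:R +
  t) * ln L)) * (eps L / eps L ^+ d))); last first.
  rewrite exprMn; field; rewrite !expf_neq0 ?gt_eqF ?expR_gt0//.
apply: ler_wpM2l; first by rewrite divr_ge0 ?(ltW c0)// !mulr_ge0.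
rewrite eps_exp// invfM -expRN opprK.
have -> : eps L = ln L * expR (- ln L) by rewrite expRN lnK.
rewrite [leLHS](_ : _ = (ln L / ln L ^+ d) * (expR (- ((d%:R + t) * ln L)) *
   expR (- ln L) * expR (d%:R * ln L))); last by ring.
rewrite -!expRD (_ : _ + _ + _ = - (1 + t) * ln L); last by ring.
rewrite ler_piMl ?expR_ge0// ler_pdivrMr ?exprn_gt0// mul1r.
by case: (d) d0 => // n _; rewrite exprS ler_peMr ?(ltW y0)// exprn_ege1.
Unshelve. all: end_near. Qed.

(** The dilation is [s = L^(-1/alpha)], so [s^alpha = 1 / L]. The exponent then loses only
    [1 + b * eps L], while [s^-d = L^(d/alpha)]; with this [b] the product is of order [L^-2]. *)
Lemma near_high_term (b t' : R) : b = d%:R / alpha + 2 -> t' < 1 ->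
  \forall L \near +oo,
  2 * expR L * (expR (- ((1 - (L^-1 `^ alpha^-1) `^ alpha) * (L + b * ln L))) *
     (L^-1 `^ alpha^-1)^-1 ^+ d) <= expR (- ((1 + t') * ln L)).
Proof.
move=> bE t1.
have b0 : 0 <= b by rewrite bE addr_ge0// divr_ge0// ltW.
near=> L.
have L0 : 0 < L by near: L; exact: nbhs_pinfty_gt.
have /andP[e0 e1] : 0 < eps L <= 1 by near: L; exact: near_eps.
have Li : 0 <= L^-1 by rewrite invr_ge0 ltW.
rewrite -powRrM mulVf ?gt_eqF// powRr1//.
apply: (@le_trans _ _ (2 * expR (1 + b) * expR (- 2 * ln L))); last first.
  rewrite -mulNr; near: L; apply: near_const_le; lra.
rewrite -!mulrA ler_pM2l// mulrA -expRD.
have -> : (L^-1 `^ alpha^-1)^-1 ^+ d = expR (d%:R / alpha * ln L).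
  rewrite -powRN -powR_mulrn ?powR_ge0// -powRrM powR_expR_ln ?invr_gt0//.
  rewrite lnV ?posrE//; congr expR; ring.
rewrite -!expRD ler_expR.
have -> : L - (1 - L^-1) * (L + b * ln L) + d%:R / alpha * ln L =
    1 + b * eps L + (d%:R / alpha - b) * ln L.
  by rewrite /eps; field; rewrite !gt_eqF.
have -> : d%:R / alpha - b = - 2 by rewrite bE; ring.
by rewrite lerD2r lerD2l ler_piMr.
Unshelve. all: end_near. Qed.

Definition radius (q L : R) : R := q * eps L * rad lambda alpha L.

(** The tested index [i] ranges up to [N] and may lie outside the segment, so the cardinal is [n] or
    [n - 1]. *)
Lemma punctured_segment (n i : nat) : exists J : {fset nat},
  [/\ forall j, j \in J = (j < n)%N && (j != i),
    (n - 1 <= #|` J|)%N & i \notin J].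
Proof.
pose J0 := seq_fset tt (iota 0 n).
have cJ0 : #|` J0| = n by rewrite size_seq_fset undup_id ?iota_uniq// size_iota.
exists (J0 `\ i)%fset; split.
- by move=> j; rewrite in_fsetD1 andbC; congr (_ && _);
  rewrite seq_fsetE mem_iota.
- have := cardfsD1 i J0; rewrite cJ0; case: (i \in J0) => /= ->;
  first by rewrite add1n subn1.
  by rewrite add0n leq_subr.
- by rewrite in_fsetD1 eqxx.
Qed.

Lemma upper_near (q : R) : d%:R < alpha * q -> exists2 t : R, 0 < t &
  \forall L \near +oo, forall n N : nat, n%:R = expR L -> N%:R = 2 * expR L ->
    outer_le P [set z | exists2 i, (i < N)%N & forall j, (j < n)%N -> j != i ->
        ~ (edist (X i z) (X j z) <= radius q L)]
      (expR (- ((1 + t) * ln L)))%:E.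
Proof.
move=> dq.
have half1 : 2^-1 <= 1 - 2^-1 :> R by lra.
have dn0 : 0 < d%:R :> R by rewrite ltr0n.
have aq0 : 0 < alpha * q by exact: lt_trans dq.
have q0 : 0 < q by rewrite -(pmulr_rgt0 _ alpha0).
(* The excess of [alpha * q] over [d] is at least [4 * t]. The shortened radius below costs one [t],
   which leaves a drop strictly above [d + 2 * t]; the cap is for [near_high_term]. *)
pose t := Num.min ((alpha * q - d%:R) / 4) (2^-1 : R).
have t0 : 0 < t by rewrite lt_min divr_gt0 ?subr_gt0//= invr_gt0.
have t1 : t <= 2^-1 by rewrite ge_min lexx orbT.
have t4 : 4 * t <= alpha * q - d%:R.
  by rewrite mulrC -ler_pdivlMr// ge_min lexx.
have [dl [dl0 dlE]] : exists dl, 0 < dl /\ 5 * dl * (alpha * q) = t.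
  exists (t / (5 * (alpha * q))); split; first by rewrite divr_gt0// mulr_gt0.
  by field; rewrite !gt_eqF.
have dl5 : 5 * dl < 1.
  by rewrite -(ltr_pM2r aq0) dlE; lra.
have [w [w0 _ wE]] := @conic_annulus_volume R d setT measurableT (fun _ _ _ =>
  conj id id).
exists (t / 2); first by rewrite divr_gt0.
pose a : R := d%:R / alpha - d%:R - 2.
pose b : R := d%:R / alpha + 2.
have ab : a < b by rewrite /a /b; lra.
pose c := (2 * (dl * q / d%:R)) ^+ d.
have c0 : 0 < c.
  by rewrite exprn_gt0//; apply: mulr_gt0 => //; apply: divr_gt0 => //;
    exact: mulr_gt0.
pose K := d%:R / alpha * (b - a) + 1.
have K0 : 0 <= K by rewrite addr_ge0// mulr_ge0 ?subr_ge0 ?(ltW ab)//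
  divr_ge0// ltW.
have A0 : 0 < A by exact: norm_const_gt0 lawE.
near=> L => n N nE NE.
have L0 : 0 < L by near: L; exact: nbhs_pinfty_gt.
have /andP[e0 e1] : 0 < eps L <= 1 by near: L; exact: near_eps.
have r0 := @rad_gt0 R lambda alpha lambda0 L L0.
have L4 : 4 <= L by near: L; exact: nbhs_pinfty_ge.
have e2 : 4 <= expR L by apply: le_trans (expR_ge1Dx _);
  rewrite (le_trans L4)// lerDr.
have ha : `|a * eps L| <= 1 by near: L; exact: near_eps_mul.
have hb : `|b * eps L| <= 1 by near: L; exact: near_eps_mul.
have hq : `|q * eps L| <= 2^-1 by near: L; exact: near_eps_mul.
have half0 : 0 < 2^-1 :> R by rewrite invr_gt0.
have /andP[sa _] : (1 - 2^-1) * rad lambda alpha L <= shell lambda alpha a L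
    <= (1 + 2^-1) * rad lambda alpha L by near: L; exact: near_shell_ratio.
have hdrop : forall t', shell lambda alpha a L <= t' <=
  shell lambda alpha b L ->
  (d%:R + 2 * t) * ln L <= lambda * t' `^ alpha -
     lambda * (t' - ((1 - 5 * dl) * q) * eps L * rad lambda alpha L) `^ alpha
       <= (alpha * q) * ln L.
  near: L; apply: near_potential_drop => //;
    first by rewrite mulr_gt0// subr_gt0.
  - have -> : alpha * ((1 - 5 * dl) * q) = alpha * q - 5 * dl * (alpha * q) by
    ring.
    rewrite dlE; lra.
  - have -> : alpha * ((1 - 5 * dl) * q) = alpha * q - 5 * dl * (alpha * q) by
    ring.
    rewrite dlE; lra.
have /andP[_ hvol] : 0 * eps L * rad lambda alpha L ^+ d <=
   shell lambda alpha b L ^+ d - shell lambda alpha a L ^+ d <=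
     K * eps L * rad lambda alpha L ^+ d.
  near: L; apply: near_shell_volume => //; last by rewrite /K ltrDl.
  by rewrite mulr_gt0// ?subr_gt0// divr_gt0.
have rr0 : 0 < radius q L by rewrite mulr_gt0// mulr_gt0.
have s0 : 0 < L^-1 `^ alpha^-1 by rewrite powR_gt0// invr_gt0.
have s1 : (L^-1 `^ alpha^-1) `^ alpha <= 1.
  by rewrite -powRrM mulVf ?gt_eqF// powRr1 ?invr_ge0 ?(ltW L0)// invf_le1//.
have rho_a : radius q L <= shell lambda alpha a L.
  by apply: le_trans sa; rewrite ler_pM2r//; move: hq;
    rewrite (gtr0_norm (mulr_gt0 q0 e0)) => /le_trans; exact.
have sa0 : 0 < shell lambda alpha a L by exact: lt_le_trans rho_a.
have {}ha := one_plus_ge0 ha.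
have {}hb := one_plus_ge0 hb.
have rho_ab : shell lambda alpha a L <= shell lambda alpha b L.
  rewrite ler_pM2l//; apply: ge0_ler_powR; rewrite ?nnegrE ?invr_ge0 ?(ltW
    alpha0)//.
  by rewrite lerD2l ler_pM2r// ltW.
have m0 : 0 < expR L / 2 by rewrite divr_gt0// expR_gt0.
set bound := expR (- (expR L / 2 * (A * expR (- (L + a * ln L)) *
      (c * (eps L * rad lambda alpha L) ^+ d)))) +
   expR (- ((d%:R + 2 * t) * ln L)) * (w * (K * eps L * rad lambda alpha L ^+
     d)) /
     (expR L / 2 * (c * (eps L * rad lambda alpha L) ^+ d)) +
   (expR (- ((1 - (L^-1 `^ alpha^-1) `^ alpha) * (L + b * ln L))) *
     (L^-1 `^ alpha^-1)^-1 ^+ d).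
have cE : (2 * (dl * radius q L / d%:R)) ^+ d =
  c * (eps L * rad lambda alpha L) ^+ d.
  by rewrite /c -exprMn; congr (_ ^+ _); rewrite /radius; ring.
have v0 : 0 < c * (eps L * rad lambda alpha L) ^+ d.
  by apply: mulr_gt0 => //; rewrite exprn_gt0// mulr_gt0.
have bound_i i : outer_le P [set z | forall j, (j < n)%N -> j != i ->
        ~ (edist (X i z) (X j z) <= radius q L)] bound%:E.
  have [J [JE Jn iJ]] := punctured_segment n i.
  have Jm : expR L / 2 <= #|` J|%:R.
    apply: (@le_trans _ _ (n%:R - 1)); first by rewrite nE; exact: half_le_pred.
    by rewrite lerBlDr natr1 ler_nat -add1n -leq_subLR.
  have J0 : (0 < #|` J|)%N by rewrite -(ltr0n R) (lt_le_trans m0).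
  have drop t' : shell lambda alpha a L <= t' <= shell lambda alpha b L ->
      (d%:R + 2 * t) * ln L <= lambda * t' `^ alpha -
        lambda * (t' - (1 - 5 * dl) * radius q L) `^ alpha.
    by move=> /hdrop/andP[+ _]; rewrite /radius !mulrA.
  have avol : mu (annulus (shell lambda alpha a L) (shell lambda alpha b L)) =
     (w * (shell lambda alpha b L ^+ d - shell lambda alpha a L ^+ d))%:E.
    by have := wE _ _ sa0 rho_ab; rewrite setTI.
  have := isolated_bound d0 lambda0 alpha0 Xindep Xlaw lawE dl0 dl5 rr0 rho_a
    rho_ab drop s0 s1 avol iJ J0
    (shell_potential lambda0 alpha0 L0 ha) (shell_potential lambda0 alpha0 L0
      hb).
  apply: outer_le_sub => [z hz j|].
    by rewrite JE => /andP[jn ji]; exact: hz.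
  rewrite lee_fin cE; apply: lerD => //; apply: lerD.
    rewrite ler_expR lerN2 ler_wpM2r//.
    by apply: mulr_ge0; [exact: mulr_ge0 (ltW A0) (expR_ge0 _)|exact: ltW].
  apply: ler_pM => //.
  - by rewrite !mulr_ge0 ?expR_ge0// subr_ge0 lerXn2r ?nnegrE// ltW//
    (lt_le_trans sa0).
  - by rewrite invr_ge0 mulr_ge0// ltW.
  - by rewrite ler_wpM2l ?expR_ge0// ler_wpM2l.
  - rewrite lef_pV2 ?posrE; first by rewrite ler_pM2r.
      by apply: mulr_gt0 => //; rewrite ltr0n.
    exact: mulr_gt0.
have bound0 : 0 <= bound.
  rewrite !addr_ge0 ?expR_ge0//.
  - apply: divr_ge0; last exact: mulr_ge0 (ltW m0) (ltW v0).
    apply: mulr_ge0; first exact: expR_ge0.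
    apply: mulr_ge0 => //; apply: mulr_ge0; first exact: mulr_ge0 K0 (ltW e0).
    exact: exprn_ge0 (ltW r0).
  - by rewrite mulr_ge0 ?expR_ge0// exprn_ge0// invr_ge0 ltW.
have := outer_le_bigcup_ord (n := N) (b := bound%:E) _ (fun i _ => bound_i i).
rewrite lee_fin => /(_ bound0); apply: outer_le_sub => [z [i iN hi]|];
  first by exists i.
rewrite -EFinM lee_fin NE /bound !(mulrDr (2 * expR L)).
(* Each of the three regimes is bounded with exponent [1 + 2 t / 3]; the gap to [1 + t / 2] absorbs
   the factor 3. *)
apply: (@le_trans _ _ (3 * expR (- (1 + 2 / 3 * t) * ln L))); last first.
  rewrite -[in leRHS]mulNr; near: L; apply: near_const_le; lra.
rewrite (_ : 3 * _ = expR (- (1 + 2 / 3 * t) * ln L) + expR (- (1 +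
  2 / 3 * t) * ln L) +
  expR (- (1 + 2 / 3 * t) * ln L)); last by ring.
rewrite mulNr; apply: lerD; first apply: lerD.
- near: L; exact: near_low_term.
- near: L; apply: near_mid_term => //; lra.
- near: L; apply: (@near_high_term b (2 / 3 * t)); first by [].
  lra.
Unshelve. all: end_near. Qed.

End upper_asymptotics.

(** * Close pairs in separated cones *)

Section cones.
Context (R : realType) (d : nat) (i0 i1 : 'I_d).
Implicit Types (x z : Rtuple R d) (a b e : R) (l m : nat).

Definition halfspace a i b j : set (Rtuple R d) :=
  [set x | a * tnth x i <= b * tnth x j].

Lemma measurable_halfspace a i b j : measurable (halfspace a i b j).
Proof.
have mg : measurable_fun setT (fun x : Rtuple R d => (a * tnth x i - b * tnth x
  j : R)).
  apply: measurable_funB; apply: measurable_funM => //; exact: measurable_tnthR.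
have := mg measurableT _ (measurable_itv `]-oo, (0 : R)]).
rewrite setTI; congr measurable; apply/seteqP; split => x /=;
  by rewrite /halfspace/= in_itv/= subr_le0.
Qed.

(** The slope of coordinate [i1] over [i0] lies between [2 l / 2 m] and [(2 l + 1) / 2 m], the odd
    intervals being left as gaps. Dominance of coordinate [i0] makes it comparable to the norm. *)
Definition cone m l : set (Rtuple R d) :=
  [set x | [/\ 0 < tnth x i0, forall i, `|tnth x i| <= tnth x i0,
    (2 * l)%:R * tnth x i0 <= (2 * m)%:R * tnth x i1 &
    (2 * m)%:R * tnth x i1 <= (2 * l + 1)%:R * tnth x i0]].

(* Each side of the cone is moved by half of the gap to the next cone. *)
Definition cone_nbhd m l : set (Rtuple R d) :=
  [set x | [/\ 0 < tnth x i0,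
    ((2 * l)%:R - 2^-1) * tnth x i0 < (2 * m)%:R * tnth x i1 &
    (2 * m)%:R * tnth x i1 < ((2 * l)%:R + 3 / 2) * tnth x i0]].

Lemma measurable_cone m l : measurable (cone m l).
Proof.
have -> : cone m l = (~` halfspace 1 i0 0 i0 `&`
   (\bigcap_(i in [set: 'I_d]) (halfspace 1 i 1 i0 `&` halfspace (-1) i 1 i0)))
     `&`
   (halfspace (2 * l)%:R i0 (2 * m)%:R i1 `&` halfspace (2 * m)%:R i1 (2 * l +
     1)%:R i0).
  apply/seteqP; split => x.
    move=> [x0 xi h1 h2]; do 2 split => //.
      by rewrite /halfspace/= mul1r mul0r; apply/negP; rewrite -ltNge.
    move=> i _; rewrite /halfspace/=; have := xi i.
    by rewrite ler_norml => /andP[h3 h4]; split; lra.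
  move=> [[x0 xi] [h1 h2]]; split => //.
    by move: x0; rewrite /halfspace/= mul1r mul0r => /negP; rewrite -ltNge.
  move=> i; have [] := xi i I; rewrite /halfspace/= => h3 h4.
  by rewrite ler_norml; apply/andP; split; lra.
apply: measurableI; last by apply: measurableI; exact: measurable_halfspace.
apply: measurableI; first by apply: measurableC; exact: measurable_halfspace.
apply: fin_bigcap_measurable => // i _.
by apply: measurableI; exact: measurable_halfspace.
Qed.

Lemma conic_cone m l : conic (cone m l).
Proof.
move=> t x t0; rewrite /cone/= !tnth_tscale pmulr_rgt0//.
rewrite !(mulrCA _ t) !ler_pM2l//; split => -[h1 h2 h3 h4]; split => // i;
  have := h2 i;
  by rewrite tnth_tscale normrM gtr0_norm// ler_pM2l.
Qed.

Lemma trivIset_cone_nbhd m : trivIset setT (cone_nbhd m).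
Proof.
move=> l l' _ _ [x [[x0 h1 h2] [_ h3 h4]]].
apply/eqP; rewrite eqn_leq; apply/andP; split; rewrite leqNgt; apply/negP => ll.
- have : ((2 * l')%:R + 3 / 2 : R) * tnth x i0 <=
  ((2 * l)%:R - 2^-1) * tnth x i0.
    rewrite ler_pM2r//.
    have : ((2 * l')%:R + 2%:R : R) <= (2 * l)%:R by rewrite -natrD ler_nat;
      lia.
    lra.
  lra.
- have : ((2 * l)%:R + 3 / 2 : R) * tnth x i0 <=
  ((2 * l')%:R - 2^-1) * tnth x i0.
    rewrite ler_pM2r//.
    have : ((2 * l)%:R + 2%:R : R) <= (2 * l')%:R by rewrite -natrD ler_nat;
      lia.
    lra.
  lra.
Qed.

(** Dominance gives [enorm x <= d * x_i0], hence [x_i0 > (8 m + 1) e]. A move by [e] shifts each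
    side condition by at most [4 m e], less than half of the new coordinate [i0], which is the
    margin of [cone_nbhd]. *)
Lemma cone_nbhd_near m l x z e : (l < m)%N -> 0 <= e -> cone m l x ->
  d%:R * ((8 * m + 1)%:R * e) < enorm x ->
  (forall i, `|tnth z i - tnth x i| <= e) -> cone_nbhd m l z.
Proof.
move=> lm e0 [x0 xi h1 h2] ex zx.
have dn0 : 0 < d%:R :> R by rewrite ltr0n; case: (d) i0 => // -[].
have x0e : (8 * m + 1)%:R * e < tnth x i0.
  rewrite -(ltr_pM2l dn0); apply: lt_le_trans ex _.
  by apply: enorm_le => //; exact: ltW.
have := zx i0; rewrite ler_norml => /andP[z1 z2].
have := zx i1; rewrite ler_norml => /andP[z3 z4].
have lm' : ((2 * l)%:R + 1 : R) <= (2 * m)%:R by rewrite natr1 ler_nat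
  ltn_pmul2l.
have m1 : (2 : R) <= (2 * m)%:R by rewrite ler_nat leq_pmulr// (leq_ltn_trans _
  lm).
rewrite /cone_nbhd/=; move: x0e h1 h2 lm' m1;
  rewrite (natrD _ (8 * m) 1) (natrD _ (2 * l) 1) !natrM.
move: (l%:R : R) (m%:R : R) (ler0n R l).
move=> L M L0 x0e h1 h2 lm' m1.
have Me : 0 <= M * e by apply: mulr_ge0 => //; lra.
have h3 : L * (tnth x i0 - e) <= L * tnth z i0 by apply: ler_wpM2l => //; lra.
have h4 : L * tnth z i0 <= L * (tnth x i0 + e) by apply: ler_wpM2l => //; lra.
have h5 : M * (tnth x i1 - e) <= M * tnth z i1 by apply: ler_wpM2l; lra.
have h6 : M * tnth z i1 <= M * (tnth x i1 + e) by apply: ler_wpM2l; lra.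
have h7 : (2 * L + 1) * e <= 2 * M * e by apply: ler_wpM2r.
split; lra.
Qed.

Hypothesis i01 : i0 != i1.

(** The center has coordinate [k = 1 / (2 d)] along [i0] and the middle slope of the cone along
    [i1]. The side is independent of [l], which gives one volume bound for all cones. *)
Lemma cone_contains_cube m l : (l < m)%N -> exists x,
  cube x ((8 * m * 2 * d)%:R^-1) `<=` cone m l `&` eball 1.
Proof.
move=> lm.
have d0 : (0 < d)%N by case: (d) i0 => // -[].
have dn0 : 0 < d%:R :> R by rewrite ltr0n.
pose k : R := (2 * d%:R)^-1.
have k0 : 0 < k by rewrite invr_gt0 mulr_gt0.
have M0 : 0 < m%:R :> R by rewrite ltr0n; lia.
set t := _^-1.
have tE : 8 * m%:R * t = k.
  by rewrite /t /k !natrM; field; rewrite !gt_eqF.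
have t0 : 0 < t by rewrite -(pmulr_rgt0 _ (_ : 0 < 8 * m%:R)) ?tE// mulr_gt0.
pose u : R := (2 * l%:R + 2^-1) / (2 * m%:R) * k.
have uE : 2 * m%:R * u = (2 * l%:R + 2^-1) * k.
  by rewrite /u; field; rewrite !gt_eqF.
exists [tuple (if i == i0 then k else if i == i1 then u else 0) | i < d] => v
  vx.
have := vx i0; rewrite tnth_mktuple eqxx ler_norml => /andP[v1 v2].
have := vx i1; rewrite tnth_mktuple eq_sym (negbTE i01) eqxx ler_norml =>
  /andP[v3 v4].
have m1 : 1 <= m%:R :> R by rewrite ler1n; lia.
have lm1 : l%:R + 1 <= m%:R :> R by rewrite natr1 ler_nat.
have l0 : 0 <= l%:R :> R by [].
have mt : t <= m%:R * t by rewrite ler_peMl ?(ltW t0).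
have lt : 0 <= l%:R * t by rewrite mulr_ge0 ?(ltW t0).
have lmt : (l%:R + 1) * t <= m%:R * t by rewrite ler_wpM2r// ltW.
have h1 : 2 * m%:R * (u - t) <= 2 * m%:R * tnth v i1.
  by apply: ler_wpM2l; lra.
have h2 : 2 * m%:R * tnth v i1 <= 2 * m%:R * (u + t).
  by apply: ler_wpM2l; lra.
have h3 : l%:R * tnth v i0 <= l%:R * (k + t) by apply: ler_wpM2l => //; lra.
have h4 : l%:R * (k - t) <= l%:R * tnth v i0 by apply: ler_wpM2l => //; lra.
have h5 : 2 * l%:R * tnth v i0 <= 2 * m%:R * tnth v i1 by lra.
have h6 : 2 * m%:R * tnth v i1 <= (2 * l%:R + 1) * tnth v i0 by lra.
have v0 : 0 < tnth v i0 by lra.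
have v10 : 0 <= tnth v i1.
  rewrite -(pmulr_rge0 _ (_ : 0 < 2 * m%:R)); last by rewrite mulr_gt0.
  by apply: le_trans h5; rewrite mulr_ge0// ?mulr_ge0// ltW.
have v1k : tnth v i1 <= tnth v i0.
  rewrite -(ler_pM2l (_ : 0 < 2 * m%:R)); last by rewrite mulr_gt0.
  by apply: (le_trans h6); rewrite ler_pM2r//; lra.
have vi i : `|tnth v i| <= tnth v i0.
  have [->|ii0] := eqVneq i i0; first by rewrite gtr0_norm.
  have [->|ii1] := eqVneq i i1; first by rewrite ger0_norm.
  have := vx i; rewrite tnth_mktuple (negbTE ii0) (negbTE ii1) subr0.
  by move=> /le_trans; apply; lra.
split; first by split => //; rewrite ?(natrD _ (2 * l) 1) !natrM.
rewrite /eball/=; apply: (@le_trans _ _ (d%:R * tnth v i0));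
  first exact: enorm_le (ltW v0) vi.
rewrite [leRHS](_ : 1 = d%:R * (2 * k)); last by rewrite /k; field;
  rewrite gt_eqF.
by rewrite ler_pM2l//; lra.
Qed.

End cones.

Section lower.
Context (dT : measure_display) (T : measurableType dT) (R : realType)
  (P : probability T R) (d : nat) (lambda alpha : R)
  (X : nat -> {RV P >-> Rtuple R d}) (law : probability (Rtuple R d) R).
Variables (i0 i1 : 'I_d).
Hypothesis i01 : i0 != i1.
Hypothesis lambda0 : 0 < lambda.
Hypothesis alpha0 : 0 < alpha.
Hypothesis Xindep : mutually_independent X.
Hypothesis Xlaw : forall i B, measurable B -> P (X i @^-1` B) = law B.
Local Notation A := (norm_const d lambda alpha).
Local Notation f := (@exp_power_pdf R d lambda alpha).
Local Notation mu := (lebesgue_tuple R d).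
Hypothesis lawE : forall B : set (Rtuple R d), measurable B ->
  law B = (\int[mu]_(x in B) (f x)%:E)%E.

Variables (m n N : nat) (r rho1 rho2 w : R).
Hypothesis r0 : 0 < r.
Hypothesis r_rho : d%:R * ((8 * m + 1)%:R * (2 * r)) < rho1.
Hypothesis rho12 : rho1 <= rho2.
Hypothesis w0 : 0 <= w.
Hypothesis annulus_volume : mu (annulus rho1 rho2) =
  (w * (rho2 ^+ d - rho1 ^+ d))%:E.

Let s : R := A * expR (- (lambda * rho1 `^ alpha)) * (w * (rho2 ^+ d - rho1 ^+
  d)).
Let p : R := A * expR (- (lambda * (rho1 - r) `^ alpha)) * (4 * r) ^+ d.
Let pS : R := A * expR (- (lambda * rho2 `^ alpha)) *
  ((2 * (8 * m * 2 * d)%:R^-1) ^+ d * (rho2 ^+ d - rho1 ^+ d)).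

(** Empty for [l >= m], because the hypotheses of [close_pairs] range over all [l]. *)
Let S l : set (Rtuple R d) :=
  if (l < m)%N then cone i0 i1 m l `&` annulus rho1 rho2 else set0.

Let A0 : 0 < A. Proof. exact: norm_const_gt0 lawE. Qed.

Let d1 : 1 <= d%:R :> R.
Proof. by rewrite ler1n; case: (d) i0 => // -[]. Qed.

Let r_rho1 : r <= rho1.
Proof.
apply: le_trans (ltW r_rho); rewrite mulrA; apply: (@le_trans _ _ (2 * r)).
  by move: r0; lra.
rewrite ler_peMl// ?mulr_ge0 ?(ltW r0)//.
rewrite -[leLHS]mulr1; apply: ler_pM => //.
by rewrite ler1n addn1.
Qed.

Let rho1_gt0 : 0 < rho1. Proof. exact: lt_le_trans r_rho1. Qed.

Let rho_diff : 0 <= rho2 ^+ d - rho1 ^+ d.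
Proof. by rewrite subr_ge0 lerXn2r ?nnegrE ?(ltW rho1_gt0)// (le_trans (ltW
  rho1_gt0)). Qed.

Let mcA l : measurable (cone i0 i1 m l `&` annulus rho1 rho2).
Proof. by apply: measurableI; [exact: measurable_cone|exact:
  measurable_annulus]. Qed.

Let mS l : measurable (S l).
Proof. by rewrite /S; case: ifP. Qed.

Let s0 : 0 <= s.
Proof.
apply: mulr_ge0; first exact: mulr_ge0 (ltW A0) (expR_ge0 _).
exact: mulr_ge0.
Qed.

Let p0 : 0 <= p.
Proof.
apply: mulr_ge0; first exact: mulr_ge0 (ltW A0) (expR_ge0 _).
by rewrite exprn_ge0// mulr_ge0// ltW.
Qed.

Let lawS l : (law (S l) <= s%:E)%E.
Proof.
apply: (@le_trans _ _ (law (annulus rho1 rho2))).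
  apply: le_measure; rewrite ?inE//; first exact: measurable_annulus.
  by rewrite /S; case: ifP => // _ x [].
rewrite /s EFinM -annulus_volume; apply: (law_le lawE).
- exact: measurable_annulus.
- exact: mulr_ge0 (ltW A0) (expR_ge0 _).
- by move=> x /andP[x1 _]; apply: (pdf_le lambda0 alpha0 lawE); exact: ltW.
Qed.

Let lawS_ge l : (l < m)%N -> (pS%:E <= law (S l))%E.
Proof.
move=> lm; rewrite /S lm.
have [v [v0 vE vol]] := conic_annulus_volume (measurable_cone i0 i1 m l)
  (@conic_cone R d i0 i1 m l).
have [x cx] := @cone_contains_cube R d i0 i1 i01 m l lm.
have t0 : 0 <= (8 * m * 2 * d)%:R^-1 :> R by rewrite invr_ge0.
(* The volume constant [v] of the cone is only known to exist; the inscribed cube bounds it from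
   below. *)
have vt : (2 * (8 * m * 2 * d)%:R^-1) ^+ d <= v.
  rewrite -lee_fin -vE -(lebesgue_tuple_cube x t0).
  apply: le_measure; rewrite ?inE//; first exact: measurable_cube.
  by apply: measurableI; [exact: measurable_cone|exact: measurable_eball].
apply: (@le_trans _ _ ((A * expR (- (lambda * rho2 `^ alpha)))%:E *
    mu (cone i0 i1 m l `&` annulus rho1 rho2))%E).
  rewrite vol// -EFinM lee_fin /pS; apply: ler_wpM2l.
    exact: mulr_ge0 (ltW A0) (expR_ge0 _).
  exact: ler_wpM2r.
apply: (law_ge lawE (mcA l)); first exact: mulr_ge0 (ltW A0) (expR_ge0 _).
by move=> z [_ /andP[_ z2]]; exact: (pdf_ge lambda0 alpha0 lawE).
Qed.

(** Either some truncated cone contains none of the first [n] points, or each contains one; not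
    being isolated, that point forms a close pair, and [m] such pairs occur at once. *)
Lemma no_isolated_point_bound (u1 u2 : R) :
  lambda * rho1 `^ alpha = u1 -> lambda * rho2 `^ alpha = u2 ->
  outer_le P [set z | ~ exists2 i, (i < n)%N & forall j, (j < N)%N -> j != i ->
        ~ (edist (X i z) (X j z) <= r)]
    (m%:R * expR (- (n%:R * (A * expR (- u2) *
       ((2 * (8 * m * 2 * d)%:R^-1) ^+ d * (rho2 ^+ d - rho1 ^+ d))))) +
     ((n * N)%:R * (A * expR (- u1) * (w * (rho2 ^+ d - rho1 ^+ d)) * p)) ^+
       m)%:E.
Proof.
move=> <- <-; rewrite -/s -/pS.
have [Q [mQ tQ QT Qdiam]] := @cells_exist R d r r0.
have /choice[F HF] lk : exists B : set (Rtuple R d), [/\ measurable B,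
    B `<=` cone_nbhd i0 i1 m lk.1,
    forall x y, Q lk.2 x -> S lk.1 x -> edist x y <= r -> B y &
    (law B <= p%:E)%E].
  move: lk => [l k] /=; have [QS|/set0P[x0 [Qx0 Sx0]]] := eqVneq (Q k `&` S l)
    set0.
    exists set0; split => //; last by rewrite measure0.
    by move=> x y Qx Sx _; have : (Q k `&` S l) x by []; rewrite QS.
  have [lm cx0 /andP[x01 x02]] : [/\ (l < m)%N,
    cone i0 i1 m l x0 & annulus rho1 rho2 x0].
    by move: Sx0; rewrite /S; case: ifP => // lm [].
  have r20 : 0 <= 2 * r by rewrite mulr_ge0// ltW.
  have mB : measurable (cube x0 (2 * r) `\` (@eball R d (rho1 - r))).
    by apply: measurableD; [exact: measurable_cube|exact: measurable_eball].
  have near_x0 y : cube x0 (2 * r) y -> cone_nbhd i0 i1 m l y.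
    move=> xy; apply: (cone_nbhd_near (x := x0) lm r20 cx0) => //.
    exact: lt_trans x01.
  (* The half-side [2 * r] is the cell diameter plus the distance of a close pair. Removing the ball
     caps the density: a point within [r] of the annulus has norm above [rho1 - r]. *)
  exists (cube x0 (2 * r) `\` eball (rho1 - r)); split => //.
  - by move=> y [xy _]; exact: near_x0.
  - move=> x y Qx Sx xy; split.
      move=> i; apply: le_trans (tnth_le_edist _ _ _) _.
      apply: le_trans (edist_triangle x _ _) _.
      by rewrite edistC mulr_natl mulr2n; apply: lerD => //; exact: (Qdiam k).
    move: Sx; rewrite /S lm => -[_ /andP[x1 _]]; rewrite /eball/=; apply/negP;
      rewrite -ltNge.
    rewrite ltrBlDr; apply: lt_le_trans x1 _;
      apply: le_trans (enorm_le_edist x y) _.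
    by rewrite lerD2l.
  - apply: (@le_trans _ _ ((A * expR (- (lambda * (rho1 - r) `^ alpha)))%:E *
      mu (cube x0 (2 * r) `\` eball (rho1 - r)))%E).
      apply: (law_le lawE mB); first exact: mulr_ge0 (ltW A0) (expR_ge0 _).
      move=> y [_ /negP]; rewrite /eball/= -ltNge => yr.
      by apply: (pdf_le lambda0 alpha0 lawE); rewrite ?subr_ge0// ltW.
    rewrite /p [X in (_ <= X)%E]EFinM; apply: lee_wpmul2l;
      first by rewrite lee_fin; exact: mulr_ge0 (ltW A0) (expR_ge0 _).
    apply: (@le_trans _ _ (mu (cube x0 (2 * r)))).
      by apply: le_measure; rewrite ?inE//; exact: measurable_cube.
    by rewrite lebesgue_tuple_cube// mulrA -natrM.
have tN := sub_trivIset (@subsetT _ [set l | (l < m)%N]) (@trivIset_cone_nbhd R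
  d i0 i1 m).
have SN l : S l `<=` cone_nbhd i0 i1 m l.
  rewrite /S; case: ifPn => // lm x [cx /andP[x1 _]].
  apply: (cone_nbhd_near (x := x) lm _ cx (e := 0)) => //.
    by rewrite !mulr0 (lt_trans rho1_gt0).
  by move=> i; rewrite subrr normr0.
have mF l k : measurable (F (l, k)) by case: (HF (l, k)).
have FN l k : F (l, k) `<=` cone_nbhd i0 i1 m l by case: (HF (l, k)).
have QF l k x y : Q k x -> S l x -> edist x y <= r -> F (l, k) y.
  by case: (HF (l, k)) => _ _ + _; exact.
have lawF l k : (law (F (l, k)) <= p%:E)%E by case: (HF (l, k)).
have pairs := close_pairs Xindep Xlaw (close := fun x y => edist x y <= r)
  (B := fun l k => F (l, k)) n N mS mQ mF tQ QT SN FN QF s0 p0 lawS lawF tN.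
pose J := seq_fset tt (iota 0 n).
have cJ : #|` J| = n by rewrite size_seq_fset undup_id ?iota_uniq// size_iota.
have empty l : (l < m)%N -> outer_le P [set z | forall i, i \in J ->
  ~ S l (X i z)]
    (expR (- (n%:R * pS)))%:E.
  by move=> lm; have := empty_sector Xindep Xlaw J (mS l) (lawS_ge lm);
    rewrite cJ.
have := outer_leU (outer_le_bigcup_ord (n := m) _ empty) pairs.
rewrite lee_fin expR_ge0 => /(_ isT); apply: outer_le_sub;
  last by rewrite -EFinM -EFinD.
move=> z /= nz.
have [[l [lm Sl]]|ne] := pselect (exists l, (l < m)%N /\ forall i,
  i \in J -> ~ S l (X i z)).
  by left; exists l.
right => l lm; apply: contrapT => ncp; apply: ne; exists l; split => // i.
rewrite seq_fsetE mem_iota/= add0n => iN Si; apply: nz;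
  exists i => // j jN ji cl.
by apply: ncp; exists i, j; split => //; split => //; rewrite eq_sym.
Qed.

End lower.

(** * Lower asymptotics *)

Lemma near_exp_stretched (R : realType) (c C k sg : R) : 0 < c -> 0 < C ->
  0 < sg ->
  \forall L \near +oo, C * expR (- (c * expR (sg * ln L))) <=
    expR (- (k * ln (L : R))).
Proof.
move=> c0 C0 sg0; near=> L.
have y1 : 1 <= ln L by near: L; exact: near_ln_ge.
have h : (`|k| + `|ln C|) / c * ln L ^+ 1 * expR (0 * ln L) <= expR (sg * ln L).
  by near: L; apply: near_polyln_expR => //; rewrite divr_ge0 ?addr_ge0// ltW.
move: h; rewrite expr1 mul0r expR0 mulr1 mulrAC ler_pdivrMr// mulrDl => h.
rewrite -{1}(@lnK _ C) ?posrE// -expRD ler_expR.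
have h1 : k * ln L <= `|k| * ln L by rewrite ler_wpM2r ?ler_norm// (le_trans _
  y1).
have h2 : ln C <= `|ln C| * ln L.
  by apply: (le_trans (ler_norm _)); rewrite ler_peMr.
lra.
Unshelve. all: end_near. Qed.

Section lower_asymptotics.
Context (dT : measure_display) (T : measurableType dT) (R : realType)
  (P : probability T R) (d : nat) (lambda alpha : R)
  (X : nat -> {RV P >-> Rtuple R d}) (law : probability (Rtuple R d) R).
Hypothesis d2 : (2 <= d)%N.
Hypothesis lambda0 : 0 < lambda.
Hypothesis alpha0 : 0 < alpha.
Hypothesis Xindep : mutually_independent X.
Hypothesis Xlaw : forall i B, measurable B -> P (X i @^-1` B) = law B.
Local Notation A := (norm_const d lambda alpha).
Local Notation f := (@exp_power_pdf R d lambda alpha).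
Local Notation mu := (lebesgue_tuple R d).
Local Notation shell := (shell lambda alpha).
Local Notation rad := (rad lambda alpha).
Local Notation radius := (radius lambda alpha).
Hypothesis lawE : forall B : set (Rtuple R d), measurable B ->
  law B = (\int[mu]_(x in B) (f x)%:E)%E.

Lemma lower_near (q : R) : 0 < q -> alpha * q < d%:R - 1 ->
  \forall L \near +oo, forall n N : nat, n%:R = expR L -> N%:R = 2 * expR L ->
    outer_le P [set z | ~ exists2 i, (i < n)%N & forall j, (j < N)%N ->
      j != i ->
        ~ (edist (X i z) (X j z) <= radius q L)]
      (expR (- (2 * ln L)))%:E.
Proof.
move=> q0 aq.
have half4 : 4^-1 < 1 - 2^-1 :> R by lra.
have half1 : 0 < 1 - 2^-1 :> R by lra.
have [i0 [i1 i01]] : exists i0 i1 : 'I_d, i0 != i1.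
  by exists (Ordinal (ltnW d2)), (Ordinal d2).
have d0 : (0 < d)%N by exact: ltnW.
have dn0 : 0 < d%:R :> R by rewrite ltr0n.
have A0 : 0 < A by exact: norm_const_gt0 lawE.
(* Budget of exponents: the level [s1] contributes [4 t] to the number of pairs, against [- 16 t]
   here; the potential drop gives away [4 t] more, and constants with powers of [ln L] another
   [4 t]. This leaves [L^(- 4 t)] per pair. *)
have [t t0 tE] : exists2 t : R, 0 < t & alpha * q = d%:R - 1 - 16 * t.
  exists ((d%:R - 1 - alpha * q) / 16); first by rewrite divr_gt0// subr_gt0.
  by field.
(* Enough cones to reach [L^-3], whose excess over the claimed [L^-2] absorbs the final factor 2. *)
have [m m0 mt] : exists2 m : nat, (0 < m)%N & 3 <= m%:R * (4 * t).
  exists (Num.bound (3 / (4 * t))).+1 => //.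
  rewrite -ler_pdivrMr ?mulr_gt0//; apply/ltW/(@lt_trans _ _ (Num.bound (3 / (4
    * t)))%:R).
    by apply: archi_boundP; rewrite divr_ge0// mulr_ge0// ltW.
  by rewrite ltr_nat.
have mn0 : 0 < m%:R :> R by rewrite ltr0n.
have [w [w0 _ wE]] := @conic_annulus_volume R d setT measurableT (fun _ _ _ =>
  conj id id).
(* At level [d / alpha - 1] the expected number of points is of order one up to logarithms. Just
   below it, at [s2], it is at least of order [L^t], so an empty cone is stretched exponentially
   unlikely. *)
have [s1 s1E] : exists s1, s1 = d%:R / alpha - 1 - 2 * t by eexists.
have [s2 s2E] : exists s2, s2 = d%:R / alpha - 1 - t by eexists.
have s12 : s1 < s2 by lra.
have da0 : 0 < d%:R / alpha by rewrite divr_gt0.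
have vol0 : 0 < d%:R / alpha * (s2 - s1) by rewrite mulr_gt0// subr_gt0.
set V := d%:R / alpha * (s2 - s1) in vol0.
pose lam := lambda `^ (- (d%:R / alpha)).
have lam0 : 0 < lam by rewrite powR_gt0.
pose c1 : R := (2 * (8 * m * 2 * d)%:R^-1) ^+ d.
have c10 : 0 < c1 by rewrite exprn_gt0// mulr_gt0// invr_gt0 ltr0n !muln_gt0 m0
  d0.
pose c := A * c1 * (V / 2) * lam.
have c0 : 0 < c.
  by apply: mulr_gt0 => //; apply: mulr_gt0; [exact: mulr_gt0|exact: divr_gt0].
pose C := 2 * A * A * w * (2 * V) * (4 * q) ^+ d * lam * lam.
have C0 : 0 <= C.
  do 2 (apply: mulr_ge0; last exact: ltW).
  apply: mulr_ge0; last by rewrite exprn_ge0// mulr_ge0// ltW.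
  apply: mulr_ge0; last by rewrite mulr_ge0// ltW.
  by apply: mulr_ge0 => //; do 2 (apply: mulr_ge0; last exact: ltW).
near=> L => n N nE NE.
have L0 : 0 < L by near: L; exact: nbhs_pinfty_gt.
have y1 : 1 <= ln L by near: L; exact: near_ln_ge.
have /andP[e0 e1] : 0 < eps L <= 1 by near: L; exact: near_eps.
have r0 := @rad_gt0 R lambda alpha lambda0 L L0.
have h1 : `|s1 * eps L| <= 1 by near: L; exact: near_eps_mul.
have h2 : `|s2 * eps L| <= 1 by near: L; exact: near_eps_mul.
have hm : `|(d%:R * ((8 * m + 1)%:R * (2 * q))) * eps L| <= 4^-1.
  by near: L; apply: near_eps_mul; rewrite invr_gt0.
have half0 : 0 < 2^-1 :> R by rewrite invr_gt0.
have /andP[sa _] : (1 - 2^-1) * rad L <= shell s1 L <= (1 + 2^-1) * rad L.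
  by near: L; exact: near_shell_ratio.
have hdrop : forall t', shell s1 L <= t' <= shell s2 L ->
  (alpha * q - 1) * ln L <= lambda * t' `^ alpha -
     lambda * (t' - q * eps L * rad L) `^ alpha <= (alpha * q + 4 * t) * ln L.
  by near: L; apply: near_potential_drop => //; lra.
have /andP[hv1 hv2] : (V / 2) * eps L * rad L ^+ d <=
   shell s2 L ^+ d - shell s1 L ^+ d <= (2 * V) * eps L * rad L ^+ d.
  near: L; apply: near_shell_volume => //; rewrite -/V; lra.
have rr0 : 0 < radius q L by rewrite mulr_gt0// mulr_gt0.
have r_rho : d%:R * ((8 * m + 1)%:R * (2 * radius q L)) < shell s1 L.
  apply: lt_le_trans sa; rewrite /radius.
  have -> : d%:R * ((8 * m + 1)%:R * (2 * (q * eps L * rad L))) =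
    (d%:R * ((8 * m + 1)%:R * (2 * q))) * eps L * rad L by ring.
  rewrite ltr_pM2r//; apply: le_lt_trans (ler_norm _) _;
    exact: le_lt_trans hm half4.
have sa0 : 0 < shell s1 L by apply: lt_le_trans sa; exact: mulr_gt0.
have {}h1 := one_plus_ge0 h1.
have {}h2 := one_plus_ge0 h2.
have rho12 : shell s1 L <= shell s2 L.
  rewrite ler_pM2l//; apply: ge0_ler_powR; rewrite ?nnegrE ?invr_ge0 ?(ltW
    alpha0)//.
  by rewrite lerD2l ler_pM2r// ltW.
have avol : mu (annulus (shell s1 L) (shell s2 L)) =
     (w * (shell s2 L ^+ d - shell s1 L ^+ d))%:E.
  by have := wE _ _ sa0 rho12; rewrite setTI.
have diff0 : 0 <= shell s2 L ^+ d - shell s1 L ^+ d.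
  apply: le_trans hv1; apply: mulr_ge0; last exact: exprn_ge0 (ltW r0).
  by apply: mulr_ge0; [rewrite divr_ge0// ltW|exact: ltW].
have radE := eps_rad_exp d lambda0 alpha0 L0.
have erE : eps L * rad L ^+ d = lam * (ln L * expR ((d%:R / alpha - 1) * ln L)).
  rewrite rad_exp// (_ : (d%:R / alpha - 1) * ln L = d%:R / alpha * ln L +
    - ln L); last by ring.
  by rewrite expRD expRN lnK ?posrE// /eps /lam; ring.
have := no_isolated_point_bound i01 lambda0 alpha0 Xindep Xlaw lawE n N rr0
  r_rho rho12 w0 avol
  (shell_potential lambda0 alpha0 L0 h1) (shell_potential lambda0 alpha0 L0 h2).
apply: outer_le_sub; first exact: subset_refl.
rewrite lee_fin.
apply: (@le_trans _ _ (2 * expR (- 3 * ln L))); last first.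
  rewrite -[in leRHS]mulNr; near: L; apply: near_const_le; lra.
rewrite [leRHS](_ : _ = expR (- (3 * ln L)) + expR (- (3 * ln L)));
  last by rewrite -mulNr; ring.
apply: lerD.
  apply: (@le_trans _ _ (m%:R * expR (- (c * expR (t * ln L))))); last first.
    by near: L; exact: near_exp_stretched.
  rewrite ler_pM2l// ler_expR lerN2 nE -/c1.
  apply: (@le_trans _ _ (expR L * (A * expR (- (L +
    s2 * ln L)) * (c1 * (V / 2 * eps L * rad L ^+ d))))).
    rewrite -[V / 2 * _ * _]mulrA erE [leRHS](_ : _ =
      c * (ln L * expR (t * ln L))); last first.
      have -> : t * ln L = - (s2 * ln L) + (d%:R / alpha - 1) * ln L by rewrite
        s2E; ring.
      rewrite opprD !expRD [expR (- L)]expRN /c; field.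
      by rewrite gt_eqF ?expR_gt0.
    by rewrite ler_pM2l// ler_peMl ?expR_ge0.
  apply: ler_wpM2l; first exact: expR_ge0.
  apply: ler_wpM2l; first exact: mulr_ge0 (ltW A0) (expR_ge0 _).
  by apply: ler_wpM2l; first exact: ltW.
have p0 : 0 <= A * expR (- (lambda * (shell s1 L - radius q L) `^ alpha)) * (4
  * radius q L) ^+ d.
  apply: mulr_ge0; first exact: mulr_ge0 (ltW A0) (expR_ge0 _).
  by rewrite exprn_ge0// mulr_ge0// ltW.
have s0 : 0 <= A * expR (- (L + s1 * ln L)) * (w * (shell s2 L ^+ d - shell s1
  L ^+ d)).
  apply: mulr_ge0; first exact: mulr_ge0 (ltW A0) (expR_ge0 _).
  exact: mulr_ge0.
have nN0 : 0 <= (n * N)%:R :> R by [].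
apply: (@le_trans _ _ (expR (- (4 * t) * ln L) ^+ m)); last first.
  rewrite -expRM_natl ler_expR.
  have h : 3 * ln L <= m%:R * (4 * t) * ln L by rewrite ler_wpM2r// (le_trans _
    y1).
  by rewrite mulNr mulrN lerN2 mulrA.
apply: lerXn2r; rewrite ?nnegrE ?expR_ge0//.
  by apply: mulr_ge0 => //; exact: mulr_ge0.
apply: (@le_trans _ _ (C * ln L ^+ d.+1 * expR (- (8 * t) * ln L))); last first.
  by near: L; apply: near_polyln_expR => //; rewrite ltrN2 ltr_pM2r// ltr_nat.
have drop1 : expR (- (lambda * (shell s1 L - radius q L) `^ alpha)) <=
    expR (- (L + s1 * ln L) + (alpha * q + 4 * t) * ln L).
  have sh : shell s1 L <= shell s1 L <= shell s2 L by rewrite lexx.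
  have /andP[_] := hdrop _ sh; rewrite shell_potential// => h.
  by rewrite ler_expR /radius -lerBlDl opprK addrC.
rewrite natrM nE NE.
apply: (@le_trans _ _ (expR L * (2 * expR L) *
  (A * expR (- (L + s1 * ln L)) * (w * (2 * V * eps L * rad L ^+ d)) *
   (A * expR (- (L + s1 * ln L) + (alpha * q +
     4 * t) * ln L) * (4 * radius q L) ^+ d)))).
  apply: ler_wpM2l; first by rewrite !mulr_ge0 ?expR_ge0.
  apply: ler_pM => //.
    apply: ler_wpM2l; first exact: mulr_ge0 (ltW A0) (expR_ge0 _).
    exact: ler_wpM2l.
  apply: ler_wpM2r; first by rewrite exprn_ge0// mulr_ge0// ltW.
  by rewrite ler_pM2l.
have -> : (4 * radius q L) ^+ d = (4 * q) ^+ d * (eps L * rad L) ^+ d.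
  by rewrite -exprMn; congr (_ ^+ _); rewrite /radius; ring.
rewrite radE -/lam -[2 * V * _ * _]mulrA erE.
have -> : - (8 * t) * ln L = - (s1 * ln L) + - (s1 * ln L) + (alpha * q +
  4 * t) * ln L
   + (d%:R / alpha - 1) * ln L + (d%:R / alpha - d%:R) * ln L.
  by rewrite s1E tE; ring.
rewrite opprD !expRD [expR (- L)]expRN exprS /C le_eqVlt;
  apply/orP/or_introl/eqP.
by field; rewrite gt_eqF ?expR_gt0.
Unshelve. all: end_near. Qed.

End lower_asymptotics.

(** * Dyadic blocks *)

Section dyadic_blocks.
Context (R : realType).

(* [a^-t - (a + 1)^-t >= t (a + 1)^-(1 + t)], to telescope the series. *)
Lemma powerN_increment (t a : R) : 0 < t -> 0 < a ->
  t * expR (- ((1 + t) * ln (a + 1))) <= expR (- (t * ln a)) - expR (- (t * ln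
    (a + 1))).
Proof.
move=> t0 a0; have b0 : 0 < a + 1 by rewrite addr_gt0.
have -> : - (t * ln a) = - (t * ln (a + 1)) + t * (ln (a + 1) - ln a) by ring.
have -> : - ((1 + t) * ln (a + 1)) = - (t * ln (a + 1)) + - ln (a + 1) by ring.
rewrite !expRD expRN [expR (- ln _)]expRN lnK ?posrE//.
rewrite -[X in _ <= _ - X]mulr1 -mulrBr mulrCA ler_wpM2l ?invr_ge0 ?expR_ge0//.
rewrite lerBrDl; apply: le_trans (expR_ge1Dx _).
rewrite lerD2l ler_pM2l//.
have : ln (1 + - (a + 1)^-1) <= - (a + 1)^-1.
  apply: le_ln1Dx; rewrite ltrN2 invf_lt1//; lra.
have -> : 1 + - (a + 1)^-1 = a / (a + 1) by field; rewrite gt_eqF.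
rewrite ln_div ?posrE//; lra.
Qed.

Definition block_log k : R := k%:R * ln 2.

Let ln2_gt0 : 0 < ln 2 :> R. Proof. by rewrite ln_gt0// ltr1n. Qed.

Lemma expR_block_log k : expR (block_log k) = (2 ^ k)%:R.
Proof. by rewrite expRM_natl lnK ?posrE// natrX. Qed.

Lemma near_block_log (Q : R -> Prop) :
  (\forall L \near +oo, Q L) -> \forall k \near \oo, Q (block_log k).
Proof.
move=> [M [_ MQ]]; exists (Num.bound (`|M| / ln 2)) => // k /= Mk.
apply: MQ; apply: le_lt_trans (ler_norm _) _; rewrite -ltr_pdivrMr//.
apply: lt_le_trans (archi_boundP _) _; first by rewrite divr_ge0// ltW.
by rewrite ler_nat.
Qed.

(** Comparison with a telescoping series. The shift by at least 2 makes the index at least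
    [(k + 1) + 1], the right endpoint in [powerN_increment]. *)
Lemma block_series_lty (t : R) (k0 : nat) : 0 < t -> (2 <= k0)%N ->
  (\sum_(k <oo) (expR (- ((1 + t) * ln (block_log (k + k0)))))%:E < +oo)%E.
Proof.
move=> t0 k02; pose h k : R := expR (- (t * ln (k.+1%:R : R))).
pose D : R := expR (- ((1 + t) * ln (ln 2))) / t.
have D0 : 0 < D by rewrite divr_gt0// expR_gt0.
have bD k : expR (- ((1 + t) * ln (block_log (k + k0)))) <= D * (h k - h k.+1).
  rewrite /block_log lnM ?posrE//; last by rewrite ltr0n; lia.
  rewrite mulrDr opprD expRD.
  apply: (@le_trans _ _ (D * (t * expR (- ((1 + t) * ln (k.+1%:R + 1 : R)))))).
    rewrite mulrA divfK ?gt_eqF// mulrC ler_wpM2l ?expR_ge0//.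
    rewrite ler_expR lerN2 ler_wpM2l ?addr_ge0 ?(ltW t0)//.
    rewrite natr1 ler_ln ?posrE ?ltr0n//; [|lia].
    by rewrite ler_nat; lia.
  rewrite ler_pM2l// /h -[k.+2%:R]natr1; exact: powerN_increment.
apply: (@le_lt_trans _ _ (D * h 0%N)%:E); last exact: ltry.
apply: lime_le; first by apply: is_cvg_nneseries => k _ _;
  rewrite lee_fin expR_ge0.
apply: nearW => n /=; rewrite sumEFin lee_fin.
apply: (@le_trans _ _ (\sum_(0 <= k < n) D * (h k - h k.+1))).
  by apply: ler_sum => k _; exact: bD.
rewrite -mulr_sumr ler_pM2l//.
rewrite (@telescope_sumr_eq _ 0 n (fun k => - h k))//; last first.
  by move=> k _; rewrite opprK addrC.
by rewrite opprK gerDr oppr_le0 expR_ge0.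
Qed.

(** The estimate is known only for large [L], so the events are reindexed to start late enough for
    it and for the series. *)
Lemma block_borel_cantelli (dT : measure_display) (T : measurableType dT)
    (P : probability T R) (V : R -> nat -> nat -> set T) (t : R) : 0 < t ->
  (\forall L \near +oo, forall n N : nat, n%:R = expR L -> N%:R = 2 * expR L ->
     outer_le P (V L n N) (expR (- ((1 + t) * ln L)))%:E) ->
  {ae P, forall w, \forall k \near \oo, ~ V (block_log k) (2 ^ k)%N (2 ^
    k.+1)%N w}.
Proof.
move=> t0 /near_block_log[k0 _ H].
pose k1 := (k0 + 2)%N.
have := @borel_cantelli_outer _ _ _ P
  (fun k => V (block_log (k + k1)) (2 ^ (k + k1))%N (2 ^ (k + k1).+1)%N)
  (fun k => (expR (- ((1 + t) * ln (block_log (k + k1)))))%:E).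
move=> /(_ _ (block_series_lty t0 _)).
have Hk k : outer_le P (V (block_log (k + k1)) (2 ^ (k + k1))%N (2 ^ (k +
  k1).+1)%N)
    (expR (- ((1 + t) * ln (block_log (k + k1)))))%:E.
  apply: H; first by rewrite /= /k1; lia.
    by rewrite expR_block_log.
  by rewrite expR_block_log expnS natrM.
move=> /(_ Hk); rewrite /k1 leq_addl => /(_ isT).
apply: filterS => w [k2 _ Hw]; exists (k2 + k1)%N => // k /= kk.
have := Hw (k - k1)%N; rewrite /= subnK; last by lia.
by apply; lia.
Qed.

Lemma near_blocks (Q : nat -> nat -> Prop) :
  (\forall k \near \oo, forall n, (2 ^ k <= n < 2 ^ k.+1)%N -> Q k n) ->
  \forall n \near \oo, exists k, (2 ^ k <= n < 2 ^ k.+1)%N /\ Q k n.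
Proof.
move=> [k0 _ H]; exists (2 ^ k0)%N => // n /= kn.
have n0 : (0 < n)%N by apply: leq_trans kn; rewrite expn_gt0.
have tn := trunc_log_bounds (isT : (1 < 2)%N) n0.
by exists (trunc_log 2 n); split => //; apply: H => //=; exact: trunc_log_max.
Qed.

End dyadic_blocks.

(** * From isolated points to the largest nearest neighbor distance *)

Section extremes.
Context (R : realType) (d : nat) (x : nat -> d.-tuple R).
Local Open Scope ereal_scope.

(** A neighbor among the first [m] points is present for every [n >= m], and indices below [N] cover
    every [n <= N]: one event controls a whole block. *)
Lemma largest_nn_dist_le (n N m : nat) (r : R) : (m <= n)%N -> (n <= N)%N ->
  (forall i, (i < N)%N -> exists j, [/\ (j < m)%N,
    j != i & (edist (x i) (x j) <= r)%R]) ->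
  largest_nn_dist x n <= r%:E.
Proof.
move=> mn nN H; apply: bigmax_le; first exact: leNye.
move=> i _; have [j [jm ji ij]] := H i (leq_trans (ltn_ord i) nN).
apply: (@le_trans _ _ (edist (x i) (x j))%:E); last by rewrite lee_fin.
pose j' : 'I_n := Ordinal (leq_trans jm mn).
have ji' : j' != i by [].
exact: (bigmin_le_cond _ (fun j : 'I_n => (edist (x i) (x j))%:E) ji').
Qed.

(** Dual monotonicity: the isolated point must be present from the start of the block and remain
    isolated up to its end. *)
Lemma largest_nn_dist_ge (n N m i : nat) (r : R) : (m <= n)%N -> (n <= N)%N ->
  (i < m)%N -> (forall j, (j < N)%N -> j != i -> (r <= edist (x i) (x j))%R) ->
  r%:E <= largest_nn_dist x n.
Proof.
move=> mn nN im H; have iN := leq_trans im mn.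
apply: (le_trans _ (le_bigmax _ (fun i : 'I_n => \big[mine/+oo]_(j < n | j != i)
   (edist (x i) (x j))%:E) (Ordinal iN))).
apply: le_bigmin; first exact: leey.
move=> j ji; rewrite lee_fin; apply: H; first exact: leq_trans (ltn_ord j) nN.
exact: ji.
Qed.

End extremes.

Section limits.
Context (R : realType).
Implicit Types (u : nat -> \bar R) (c : \bar R).
Local Open Scope ereal_scope.

Lemma limn_esup_le u c : (\forall n \near \oo, u n <= c) -> limn_esup u <= c.
Proof.
move=> H; apply: (@le_trans _ _ (ereal_sup (u @` [set n | u n <= c]))).
  by apply: ereal_inf_lbound; exists [set n | u n <= c].
by apply: ub_ereal_sup => _ [n /= un <-].
Qed.

Lemma limn_einf_ge u c : (\forall n \near \oo, c <= u n) -> c <= limn_einf u.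
Proof.
move=> H; rewrite /limn_einf leeNr; apply: limn_esup_le.
by apply: filterS H => n; rewrite leeN2.
Qed.

End limits.

(** * Normalization *)

Section normalization.
Context (R : realType) (lambda alpha : R).
Hypothesis lambda0 : 0 < lambda.
Local Notation radius := (radius lambda alpha).

(** The powers [1 - 1/alpha] and [1/alpha] of [L / lambda] recombine, and with [eps L = ln L / L]
    they give [ln L / lambda]. The correction equals 1 at [l = L]; within a block [l] exceeds [L] by
    at most [ln 2]. *)
Lemma normalized_radius (q L l : R) : 0 < L -> 0 < l ->
  (lambda^-1 * l) `^ (1 - alpha^-1) * radius q L / ln l =
  q / lambda * ((l / L) `^ (1 - alpha^-1) * (ln L / ln l)).
Proof.
move=> L0 l0.
have Ll : 0 < L / lambda by rewrite divr_gt0.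
have lL : 0 < l / L by rewrite divr_gt0.
have -> : lambda^-1 * l = (l / L) * (L / lambda) by field; rewrite !gt_eqF.
rewrite powRM ?(ltW Ll) ?(ltW lL)// /radius /eps /rad.
rewrite [LHS](_ : _ = ((L / lambda) `^ (1 - alpha^-1) * (L / lambda) `^
  alpha^-1) *
   (q * (ln L / L) * (l / L) `^ (1 - alpha^-1) / ln l)); last by ring.
rewrite -powRD; last by rewrite (gt_eqF Ll) implybT.
rewrite subrK powRr1 ?(ltW Ll)//.
set z := (ln l)^-1; by field; rewrite !gt_eqF.
Qed.

Lemma near_normalized_radius (q e : R) : 0 < q -> 0 < e <= 1 ->
  \forall L \near +oo, forall l, L <= l <= L + ln 2 ->
    (1 - e) * (q / lambda) <= (lambda^-1 * l) `^ (1 - alpha^-1) * radius q L /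
      ln l
      <= (1 + e) * (q / lambda).
Proof.
move=> q0 /andP[e0 e1]; set p := 1 - alpha^-1.
have [dl /andP[dl0 _] H] := @powR_increment R p 1 ltr01.
have l2 : 0 < ln 2 :> R by rewrite ln_gt0// ltr1n.
have pe0 : 0 < `|p| + 1 by rewrite ltr_wpDl.
have e20 : 0 < e / 2 by rewrite divr_gt0.
near=> L => l /andP[Ll lL].
have L0 : 0 < L by near: L; exact: nbhs_pinfty_gt.
have y1 : 1 <= ln L by near: L; exact: near_ln_ge.
have L1 : ln 2 / dl <= L by near: L; apply: nbhs_pinfty_ge; exact: num_real.
have L2 : ln 2 * (`|p| + 1) / (e / 2) <= L by near: L; apply: nbhs_pinfty_ge;
  exact: num_real.
have L3 : ln 2 / (e / 2) <= L by near: L; apply: nbhs_pinfty_ge;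
  exact: num_real.
have l0 : 0 < l by exact: lt_le_trans Ll.
rewrite normalized_radius// -/p.
have [x lE] : exists x, l = L * (1 + x) by exists (l / L - 1); field;
  rewrite gt_eqF.
have x0 : 0 <= x by move: Ll; rewrite lE mulrDr mulr1 lerDl pmulr_rge0.
have xL : L * x <= ln 2 by move: lL; rewrite lE mulrDr mulr1 lerD2l.
have -> : l / L = 1 + x by rewrite lE mulrC mulKf// gt_eqF.
have xdl : x <= dl.
  move: L1; rewrite ler_pdivrMr// => L1; rewrite -(ler_pM2l L0);
    exact: le_trans xL L1.
have xe : (`|p| + 1) * x <= e / 2.
  move: L2; rewrite ler_pdivrMr// => L2; rewrite -(ler_pM2l L0).
  by apply: le_trans L2; rewrite mulrCA mulrC ler_wpM2r// ltW.
have xe1 : x <= e / 2.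
  move: L3; rewrite ler_pdivrMr// => L3; rewrite -(ler_pM2l L0);
    exact: le_trans xL L3.
have lnl : ln L <= ln l <= ln L + x.
  rewrite ler_ln ?posrE// Ll lE lnM ?posrE//; last by rewrite ltr_wpDr.
  by rewrite lerD2l le_ln1Dx// (lt_le_trans _ x0).
move: lnl => /andP[lnl1 lnl2].
have lnl0 : 0 < ln l by exact: lt_le_trans (lt_le_trans ltr01 y1) lnl1.
have b1 : ln L / ln l <= 1 by rewrite ler_pdivrMr// mul1r.
have b2 : 1 - e / 2 <= ln L / ln l.
  rewrite ler_pdivlMr//.
  have h1 : e / 2 * 1 <= e / 2 * ln l.
    by rewrite ler_pM2l// (le_trans y1).
  move: h1 xe1 lnl2; lra.
have : `|(1 + x) `^ p - 1 `^ p - p * (1 + x - 1)| <= 1 * (1 + x - 1).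
  by apply: H; rewrite ?lerD2l// ?lerBlDr ?lerDl// (le_trans (ltW dl0))// lerDl.
rewrite powR1 mul1r (addrC 1 x) addrK (addrC x 1) => hp.
have {}hp : `|(1 + x) `^ p - 1| <= e / 2.
  apply: le_trans xe; rewrite mulrDl mul1r.
  have -> : (1 + x) `^ p - 1 = ((1 + x) `^ p - 1 - p * x) + p * x by ring.
  apply: le_trans (ler_normD _ _) _; rewrite normrM (ger0_norm x0) addrC.
  by rewrite lerD2l.
move: hp; rewrite ler_norml => /andP[hp1 hp2].
have ql : 0 < q / lambda by rewrite divr_gt0.
rewrite (mulrC (1 - e)) (mulrC (1 + e)) !ler_pM2l//.
set a := (1 + x) `^ p in hp1 hp2 *; set b := ln L / ln l in b1 b2 *.
have a1 : 1 - e / 2 <= a by move: hp1; lra.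
have a2 : a <= 1 + e / 2 by move: hp2; lra.
have b0 : 0 <= 1 - e / 2 by move: e1; lra.
apply/andP; split.
  apply: (@le_trans _ _ ((1 - e / 2) * (1 - e / 2))); last exact: ler_pM.
  have := sqr_ge0 (e / 2); rewrite expr2; lra.
apply: (@le_trans _ _ ((1 + e / 2) * 1)); last by rewrite mulr1; move: e0; lra.
apply: ler_pM => //; first exact: le_trans a1.
exact: le_trans b2.
Unshelve. all: end_near. Qed.

End normalization.

(** * Almost sure bounds *)

Lemma ae_forall_nat (dT : measure_display) (T : measurableType dT) (R :
  realType)
    (P : probability T R) (Q : nat -> T -> Prop) :
  (forall j, {ae P, forall w, Q j w}) -> {ae P, forall w, forall j, Q j w}.
Proof.
move=> H; apply: negligibleS (negligible_bigcup H) => w /= /existsNP[j nQ].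
by exists j.
Qed.

Section almost_sure_bounds.
Context (dT : measure_display) (T : measurableType dT) (R : realType)
  (P : probability T R) (d : nat) (lambda alpha : R)
  (X : nat -> {RV P >-> Rtuple R d}).
Hypothesis d2 : (2 <= d)%N.
Hypothesis lambda0 : 0 < lambda.
Hypothesis alpha0 : 0 < alpha.
Hypothesis Xindep : mutually_independent X.
Hypothesis Xdens : forall i, has_density (X i) (@exp_power_pdf R d lambda
  alpha).

Let law : probability (Rtuple R d) R := distribution P (X 0%N).

Let Xlaw i (B : set (Rtuple R d)) : measurable B -> P (X i @^-1` B) = law B.
Proof. by move=> mB; exact: etrans (Xdens i mB) (esym (Xdens 0%N mB)). Qed.

Let lawE (B : set (Rtuple R d)) : measurable B ->
  law B = (\int[lebesgue_tuple R d]_(x in B) (exp_power_pdf lambda alpha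
    x)%:E)%E.
Proof. exact: Xdens. Qed.

Definition normalized_dist (w : T) (n : nat) : \bar R :=
  (((lambda^-1 * ln n%:R) `^ (1 - alpha^-1))%:E *
        largest_nn_dist (fun i => X i w) n / (ln (ln n%:R))%:E)%E.

Let block_ln n k : (2 ^ k <= n < 2 ^ k.+1)%N ->
  block_log R k <= ln (n%:R : R) <= block_log R k + ln 2.
Proof.
move=> /andP[kn nk].
have n0 : (0 < n)%N by apply: leq_trans kn; rewrite expn_gt0.
rewrite -[_ + ln 2](_ : block_log R k.+1 = _);
  last by rewrite /block_log -natr1; ring.
by apply/andP; split; rewrite -ler_expR lnK ?posrE ?ltr0n// expR_block_log
  ler_nat// ltnW.
Qed.

Let near_normalized (q e : R) : 0 < q -> 0 < e <= 1 ->
  \forall k \near \oo, forall n, (2 ^ k <= n < 2 ^ k.+1)%N -> forall w : T,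
    (largest_nn_dist (fun i => X i w) n <= (radius lambda alpha q (block_log R
      k))%:E ->
     normalized_dist w n <= ((1 + e) * (q / lambda))%:E)%E /\
    ((radius lambda alpha q (block_log R k))%:E <=
      largest_nn_dist (fun i => X i w) n ->
     ((1 - e) * (q / lambda))%:E <= normalized_dist w n)%E.
Proof.
move=> q0 e01; have := near_block_log (near_normalized_radius alpha lambda0 q0
  e01).
have := near_block_log (@near_ln_ge R 1).
have := near_block_log (@nbhs_pinfty_gt R 0 (num_real _)).
apply: filterS3 => k L0 L1 H n nk w.
have /andP[l1 l2] := block_ln nk.
have /H/andP[h1 h2] : block_log R k <= ln (n%:R : R) <= block_log R k + ln 2.
  by rewrite l1.
(* Positivity makes the extended-real quotient a product with a nonnegative real inverse, hence
   monotone in the distance. *)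
have ll0 : 0 < ln (ln (n%:R : R)).
  by apply: lt_le_trans (le_trans L1 _); rewrite // ler_ln// posrE (lt_le_trans
    L0).
have ill0 : (0 <= (ln (ln (n%:R : R)))%:E^-1)%E.
  by rewrite inver gt_eqF// lee_fin invr_ge0 ltW.
have g0 : (0 <= ((lambda^-1 * ln (n%:R : R)) `^ (1 - alpha^-1))%:E)%E.
  by rewrite lee_fin powR_ge0.
have E : (((lambda^-1 * ln n%:R) `^ (1 - alpha^-1) * radius lambda alpha q
  (block_log R k) / ln (ln n%:R))%:E =
  ((lambda^-1 * ln n%:R) `^ (1 - alpha^-1))%:E * (radius lambda alpha q
    (block_log R k))%:E / (ln (ln n%:R))%:E)%E.
  by rewrite inver gt_eqF.
split => D.
- apply: (@le_trans _ _ (((lambda^-1 * ln n%:R) `^ (1 - alpha^-1) * radius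
  lambda alpha q (block_log R k) / ln (ln n%:R))%:E)); last by rewrite lee_fin.
  by rewrite E; apply: lee_wpmul2r => //; exact: lee_wpmul2l.
- apply: (@le_trans _ _ (((lambda^-1 * ln n%:R) `^ (1 - alpha^-1) * radius
  lambda alpha q (block_log R k) / ln (ln n%:R))%:E)); first by rewrite lee_fin.
  by rewrite E; apply: lee_wpmul2r => //; exact: lee_wpmul2l.
Qed.

Lemma ae_upper (q e : R) : d%:R < alpha * q -> 0 < e <= 1 ->
  {ae P, forall w, \forall n \near \oo, (normalized_dist w n <=
    ((1 + e) * (q / lambda))%:E)%E}.
Proof.
move=> dq e01.
have q0 : 0 < q by rewrite -(pmulr_rgt0 _ alpha0) (le_lt_trans _ dq).
have [t t0 near_bad] := upper_near (ltnW d2) lambda0 alpha0 Xindep Xlaw lawE dq.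
have := @block_borel_cantelli R _ _ P (fun L n N => [set w | exists2 i,
  (i < N)%N &
    forall j, (j < n)%N -> j != i -> ~ (edist (X i w) (X j w) <=
      radius lambda alpha q L)])
  t t0 near_bad.
apply: filterS => w good.
have : \forall k \near \oo, forall n, (2 ^ k <= n < 2 ^ k.+1)%N ->
    (normalized_dist w n <= ((1 + e) * (q / lambda))%:E)%E.
  have := near_normalized q0 e01; apply: filterS2 good => k /= good H n nk.
  have /andP[kn nk1] := nk.
  apply: (H n nk w).1; apply: (largest_nn_dist_le kn (ltnW nk1)) => i iN.
  apply: contrapT => nj; apply: good; exists i => // j jn ji ij.
  by apply: nj; exists j.
by move=> /near_blocks; apply: filterS => n [k [_]].
Qed.

Lemma ae_lower (q e : R) : 0 < q -> alpha * q < d%:R - 1 -> 0 < e <= 1 ->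
  {ae P, forall w, \forall n \near \oo, (((1 - e) * (q / lambda))%:E <=
    normalized_dist w n)%E}.
Proof.
move=> q0 dq e01.
have near_bad := lower_near d2 lambda0 alpha0 Xindep Xlaw lawE q0 dq.
have := @block_borel_cantelli R _ _ P (fun L n N => [set w | ~ exists2 i,
  (i < n)%N &
    forall j, (j < N)%N -> j != i -> ~ (edist (X i w) (X j w) <=
      radius lambda alpha q L)])
  1 ltr01 near_bad.
apply: filterS => w good.
have : \forall k \near \oo, forall n, (2 ^ k <= n < 2 ^ k.+1)%N ->
    (((1 - e) * (q / lambda))%:E <= normalized_dist w n)%E.
  have := near_normalized q0 e01; apply: filterS2 good => k /= /contrapT[i ik
    good] H n nk.
  have /andP[kn nk1] := nk.
  apply: (H n nk w).2; apply: (largest_nn_dist_ge kn (ltnW nk1) ik) => j jN ji.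
  by rewrite leNgt; apply/negP => /ltW; exact: good.
by move=> /near_blocks; apply: filterS => n [k [_]].
Qed.

End almost_sure_bounds.

Lemma small_multiple (R : realType) (c eta : R) : 0 < eta ->
  exists j : nat, c * j.+2%:R^-1 <= eta.
Proof.
move=> eta0; exists (Num.bound (`|c| / eta)).
apply: (@le_trans _ _ (`|c| * (Num.bound (`|c| / eta)).+2%:R^-1)).
  by rewrite ler_wpM2r ?invr_ge0// ler_norm.
rewrite ler_pdivrMr// mulrC -ler_pdivrMr//.
apply/ltW/(lt_le_trans (archi_boundP _)); first by rewrite divr_ge0// ltW.
by rewrite ler_nat; apply: leq_trans (leqnSn _) (leqnSn _).
Qed.

Theorem theorem1p3 (R : realType) (dT : measure_display)
  (T : measurableType dT) (P : probability T R)
  (d : nat) (hd : (2 <= d)%N) (lambda alpha : R)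
  (hlambda : 0 < lambda) (halpha : 0 < alpha)
  (X : nat -> {RV P >-> Rtuple R d})
  (Xindep : mutually_independent X)
  (Xdens : forall i, has_density (X i) (@exp_power_pdf R d lambda alpha)) :
  {ae P, forall w : T,
    (((d%:R - 1) / (alpha * lambda))%:E <=
      limn_einf (fun n : nat =>
        ((lambda^-1 * ln n%:R) `^ (1 - alpha^-1))%:E *
        largest_nn_dist (fun i => X i w) n / (ln (ln n%:R))%:E))%E /\
    (limn_esup (fun n : nat =>
        ((lambda^-1 * ln n%:R) `^ (1 - alpha^-1))%:E *
        largest_nn_dist (fun i => X i w) n / (ln (ln n%:R))%:E) <=
      (d%:R / (alpha * lambda))%:E)%E}.
Proof.
(* A sequence tending to 0, so that only countably many null sets are discarded; starting at 1/2 it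
   keeps [1 - e j], hence [ql j], positive. *)
pose e (j : nat) : R := j.+2%:R^-1.
have e0 j : 0 < e j by rewrite invr_gt0.
have e1 j : e j < 1 by rewrite invf_lt1// ltr1n.
have e01 j : 0 < e j <= 1 by rewrite e0 ltW.
have dn0 : 0 < d%:R :> R by rewrite ltr0n (ltnW hd).
have dn1 : 0 < d%:R - 1 :> R by rewrite subr_gt0 ltr1n.
(* The loss [e j] enters twice, here to make [alpha * q] strictly exceed [d] (or stay below [d - 1])
   and again in the normalization. Hence the squares below, with [(1 - e) ^+ 2 >= 1 - 2 e] and
   [(1 + e) ^+ 2 <= 1 + 3 e]. *)
pose qu j := (1 + e j) * (d%:R / alpha).
pose ql j := (1 - e j) * ((d%:R - 1) / alpha).
have hqu j : d%:R < alpha * qu j.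
  rewrite /qu mulrCA (mulrC alpha) divfK ?gt_eqF//.
  by rewrite ltr_pMl// ltrDl.
have ql0 j : 0 < ql j by rewrite mulr_gt0 ?subr_gt0// divr_gt0.
have hql j : alpha * ql j < d%:R - 1.
  rewrite /ql mulrCA (mulrC alpha) divfK ?gt_eqF//.
  by rewrite gtr_pMl// gtrDl oppr_lt0.
have := ae_forall_nat (fun j => ae_upper hd hlambda halpha Xindep Xdens (hqu j)
  (e01 j)).
have := ae_forall_nat (fun j => ae_lower hd hlambda halpha Xindep Xdens (ql0 j)
  (hql j) (e01 j)).
apply: filterS2 => w lo up; split.
- have low j := limn_einf_ge (lo j).
  apply/lee_subgt0Pr => eta eta0.
  have [j hj] := small_multiple (2 * ((d%:R - 1) / (alpha * lambda))) eta0.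
  apply: le_trans (low j); rewrite -EFinB lee_fin /ql.
  rewrite [leRHS](_ : _ = (1 - e j) ^+ 2 * ((d%:R - 1) / (alpha * lambda)));
    last first.
    by field; rewrite !gt_eqF.
  have c0 : 0 <= (d%:R - 1) / (alpha * lambda) by exact: divr_ge0 (ltW dn1)
    (mulr_ge0 (ltW halpha) (ltW hlambda)).
  have := mulr_ge0 (sqr_ge0 (e j)) c0; move: hj; rewrite -/(e j); lra.
- have high j := limn_esup_le (up j).
  apply/lee_addgt0Pr => eta eta0.
  have [j hj] := small_multiple (3 * (d%:R / (alpha * lambda))) eta0.
  apply: (le_trans (high j)); rewrite -EFinD lee_fin /qu.
  rewrite [leLHS](_ : _ = (1 + e j) ^+ 2 * (d%:R / (alpha * lambda)));
    last first.
    by field; rewrite !gt_eqF.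
  have c0 : 0 <= d%:R / (alpha * lambda) by exact: divr_ge0 (ltW dn0) (mulr_ge0
    (ltW halpha) (ltW hlambda)).
  have ee : e j ^+ 2 * (d%:R / (alpha * lambda)) <=
    e j * (d%:R / (alpha * lambda)).
    by rewrite ler_wpM2r// ler_piMl// ltW.
  move: hj ee; rewrite -/(e j); lra.
Qed.
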